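(* Let $A$ be an alphabet and let $K$ be one of $K_1$, $K_2$, $K_3$. The quantitative language-inclusion problem for weighted Büchi automata over $K$ and $A$ is decidable: there is an algorithm that, given weighted Büchi automata $\mathcal{N},\widehat{\mathcal{N}}$ over $K$ and $A$, decides whether $(\|\mathcal{N}\|,w)\le(\|\widehat{\mathcal{N}}\|,w)$ for all $w\in A^{\omega}$.
   Context: $\overline{\mathbb{Q}}=\mathbb{Q}\cup\{\infty,-\infty\}$ with its usual order. In each of $K_1,K_2,K_3$ the carrier is $\overline{\mathbb{Q}}$, addition (binary and infinitary) is $\sup$ with zero $-\infty$, product is $\inf$ with unit $\infty$; the $\omega$-valuation functions on sequences $(d_i)_{i\ge0}$ with finitely many values are: for $K_1$, $\mathrm{liminf}$: $-\infty$ if some $d_i=-\infty$; $\infty$ if all $d_i=\infty$; $\sup_{i\ge0}\inf\{d_k\mid k\ge i,d_k\ne\infty\}$ if no $-\infty$ and infinitely many $d_i\ne\infty$; $\inf\{d_i\mid d_i\ne\infty\}$ otherwise. For $K_2$, $\mathrm{limsup}$: $-\infty$ if some $d_i=-\infty$; $\infty$ if all $d_i=\infty$; $\inf_{i\ge0}\sup\{d_k\mid k\ge i,d_k\ne\infty\}$ if no $-\infty$ and infinitely many $d_i\ne\infty$; $\sup\{d_i\mid d_i\ne\infty\}$ otherwise. For $K_3$, $\sup_{-\infty}$: $-\infty$ if some $d_i=-\infty$; $\infty$ if all $d_i=\infty$; $\sup\{d_k\mid d_k\ne\infty\}$ otherwise. A weighted Büchi automaton over $A$ and $K$ is $(Q,wt,I,F)$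 with finite $Q$, $wt:Q\times A\times Q\to\overline{\mathbb{Q}}$, $I,F\subseteq Q$; the weight of a path $(q_j,a_j,q_{j+1})_{j\ge0}$ is the $\omega$-valuation of $(wt(q_j,a_j,q_{j+1}))_j$; a path is successful if $q_0\in I$ and some state of $F$ occurs infinitely often; the behavior $(\|\mathcal{A}\|,w)$ is the supremum of the weights of successful paths over $w$ ($-\infty$ if none). *)

(* Defs.v *)
From HB Require Import structures.
From mathcomp Require Import all_boot all_order all_algebra.
From mathcomp Require Import boolp classical_sets reals constructive_ereal ereal Rstruct.
Unset Printing Implicit Defensive.
Import Order.TTheory GRing.Theory Num.Theory.
Local Open Scope classical_set_scope.
Local Open Scope ereal_scope.

(* Carrier: Qbar = Q u {+oo,-oo} is represented by \bar rat.          *)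
(* Suprema/infima of the (finite-valued) sets occurring below are     *)
(* computed after the order embedding Qbar -> \bar R (R = reals);     *)
(* since all sets involved take finitely many values, these coincide  *)
(* with the suprema/infima in Qbar.                                   *)
Definition RR := Rdefinitions.R.
Definition qbar := \bar rat.
Definition qbar_to_R (x : qbar) : \bar RR := er_map (fun q : rat => (ratr q : RR)) x.

(* the three semirings K1, K2, K3 (they differ only by the omega-valuation) *)
Inductive Ksel := K1 | K2 | K3.

Definition val_liminf (d : nat -> \bar RR) : \bar RR :=
  if pselect (exists i, d i = -oo) then -oo
  else if pselect (forall i, d i = +oo) then +oo
  else if pselect (forall i, exists k, (i <= k)%N /\ d k <> +oo) then
    ereal_sup [set ereal_inf [set d k | k in [set k | (i <= k)%N /\ d k <> +oo]] | i in [set: nat]]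
  else ereal_inf [set d i | i in [set i | d i <> +oo]].

Definition val_limsup (d : nat -> \bar RR) : \bar RR :=
  if pselect (exists i, d i = -oo) then -oo
  else if pselect (forall i, d i = +oo) then +oo
  else if pselect (forall i, exists k, (i <= k)%N /\ d k <> +oo) then
    ereal_inf [set ereal_sup [set d k | k in [set k | (i <= k)%N /\ d k <> +oo]] | i in [set: nat]]
  else ereal_sup [set d i | i in [set i | d i <> +oo]].

Definition val_supninf (d : nat -> \bar RR) : \bar RR :=
  if pselect (exists i, d i = -oo) then -oo
  else if pselect (forall i, d i = +oo) then +oo
  else ereal_sup [set d k | k in [set k | d k <> +oo]].

Definition omega_val (K : Ksel) : (nat -> \bar RR) -> \bar RR :=
  match K with K1 => val_liminf | K2 => val_limsup | K3 => val_supninf end.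

(* Weighted Buchi automata over alphabet A; states 'I_n (any finite   *)
(* state set is in bijection with some 'I_n).                         *)
Record wba (A : finType) := WBA {
  nstates : nat;
  wt : {ffun 'I_nstates * A * 'I_nstates -> qbar};
  init : {set 'I_nstates};
  fin : {set 'I_nstates} }.
Arguments nstates {A}.
Arguments wt {A}.
Arguments init {A}.
Arguments fin {A}.

Definition successful {A : finType} (N : wba A) (q : nat -> 'I_(nstates N)) : Prop :=
  q 0%N \in init N /\
  exists2 f, f \in fin N & forall i, exists j, (i <= j)%N /\ q j = f.

Definition path_weight {A : finType} (K : Ksel) (N : wba A) (w : nat -> A)
  (q : nat -> 'I_(nstates N)) : \bar RR :=
  omega_val K (fun j => qbar_to_R (wt N (q j, w j, q j.+1))).

(* behaviour (||N||, w); ereal_sup of the empty set is -oo *)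
Definition behavior {A : finType} (K : Ksel) (N : wba A) (w : nat -> A) : \bar RR :=
  ereal_sup [set path_weight K N w q | q in [set q | successful N q]].

Definition qinclusion {A : finType} (K : Ksel) (N N' : wba A) : Prop :=
  forall w : nat -> A, behavior K N w <= behavior K N' w.

(* Model of computation: counter (Minsky) machines.                   *)
Inductive instr := INC of nat | DEC of nat & nat.

Definition upd (regs : nat -> nat) (r v : nat) : nat -> nat :=
  fun i => if i == r then v else regs i.

Fixpoint run (p : seq instr) (fuel pc : nat) (regs : nat -> nat) : option nat :=
  match fuel with
  | 0 => None
  | S f =>
    match List.nth_error p pc with
    | None => Some (regs 0%N)
    | Some (INC r) => run p f pc.+1 (upd regs r (regs r).+1)
    | Some (DEC r j) =>
        if regs r == 0%N then run p f j regs
        else run p f pc.+1 (upd regs r (regs r).-1)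
    end
  end.

Definition halts_with (p : seq instr) (input output : nat) : Prop :=
  exists fuel, run p fuel 0 (fun i => if i == 0%N then input else 0%N) = Some output.

Definition cpair (a b : nat) : nat := ((a + b) * (a + b).+1)./2 + b.

Fixpoint enc_list (s : seq nat) : nat :=
  if s is x :: s' then (cpair x (enc_list s')).+1 else 0%N.

Definition enc_int (z : int) : nat :=
  match z with Posz n => n.*2 | Negz n => n.*2.+1 end.

Definition enc_qbar (x : qbar) : nat :=
  match x with
  | -oo => 0%N
  | +oo => 1%N
  | EFin q => (cpair (enc_int (numq q)) (enc_int (denq q))).+2
  end.

Definition enc_wba {A : finType} (N : wba A) : nat :=
  enc_list (nstates N ::
    [seq enc_qbar (wt N t) | t <- enum [set: ('I_(nstates N) * A * 'I_(nstates N))%type]] ++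
    [seq nat_of_bool (s \in init N) | s <- enum 'I_(nstates N)] ++
    [seq nat_of_bool (s \in fin N) | s <- enum 'I_(nstates N)]).

Definition enc_pair {A : finType} (N N' : wba A) : nat := cpair (enc_wba N) (enc_wba N').

(* Main.v *)
(** To a finite word u and an automaton N attach its arrows: the tuples (p, x, b, q)
    such that some path over u leads from p to q with accumulated weight x, where b
    records a visit to a final state. A word has finitely many possible arrow sets,
    and they compose. By Ramsey's theorem every omega-word splits into a prefix and
    infinitely many blocks that all have the same, idempotent, arrow set, and every
    successful run splits into blocks carrying one and the same arrow; its weight is
    then determined by the weight of the prefix and that of one block. Hence inclusion
    fails iff some pair u, v of nonempty words, with v idempotent and absorbed by u for
    the second automaton, admits a lasso of the first automaton that is strictly heavier
    than all lassos of the second. Whether u, v is such a pair depends only on their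
    arrow sets, so by pigeonhole words of bounded length suffice, and the search is
    a computable function. *)

Require Import Defs.
From HB Require Import structures.
From mathcomp Require Import all_boot all_order all_algebra.
From mathcomp Require Import boolp classical_sets reals constructive_ereal ereal Rstruct.
From mathcomp Require Import zify.

Set Implicit Arguments.
Unset Strict Implicit.
Unset Printing Implicit Defensive.

(** * A while language and its compilation to counter machines *)

(** [halts_with] asks for an actual counter machine, so calling the search computable takes a proof
    of its own. While programs are compiled to machines; the functions they compute are closed under
    composition, pairing and iteration; lists, rationals and automata enter through their codes. As
    the length of the words has an explicit bound, bounded iteration is the only form of loop that
    the algorithm uses. The three valuations are treated together. [opw], a minimum or maximum with
    [+oo] neutral and [-oo] absorbing, folds a finite block. It never creates a new value, which is
    why arrow sets are finite in number and why suprema over infinitely many runs can be compared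
    strictly. [K2] and [K3] share [opw] and part ways only in [lasso_val], where the prefix either
    is forgotten or keeps counting. The two automata are treated asymmetrically: one run of the
    first one witnesses non-inclusion, but all runs of the second one have to be bounded. Hence
    absorption and idempotence are asked for the second automaton alone. *)

Inductive stmt :=
| Skip
| Inc of nat
| Seq of stmt & stmt
| Loop of nat & stmt
| IfDec of nat & stmt & stmt.

Notation state := (nat -> nat).

(* [Loop r s] is: while r <> 0 do { decrement r; s };
   [IfDec r s t] is: if r <> 0 then { decrement r; s } else t. *)
Inductive exec : stmt -> state -> state -> Prop :=
| ExecSkip st : exec Skip st st
| ExecInc r st : exec (Inc r) st (upd st r (st r).+1)
| ExecSeq s t st1 st2 st3 :
    exec s st1 st2 -> exec t st2 st3 -> exec (Seq s t) st1 st3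
| ExecLoop0 r s st : st r = 0 -> exec (Loop r s) st st
| ExecLoopS r s st1 st2 st3 : st1 r <> 0 ->
    exec s (upd st1 r (st1 r).-1) st2 -> exec (Loop r s) st2 st3 ->
    exec (Loop r s) st1 st3
| ExecIf0 r s t st1 st2 : st1 r = 0 ->
    exec t st1 st2 -> exec (IfDec r s t) st1 st2
| ExecIfS r s t st1 st2 : st1 r <> 0 ->
    exec s (upd st1 r (st1 r).-1) st2 -> exec (IfDec r s t) st1 st2.

(* Machine register 1 is kept at zero, so that [DEC 1 j] is a jump to j. *)
Definition mreg (r : nat) : nat := if r is r'.+1 then r'.+2 else 0.

(** Jump targets are absolute, hence the parameter [b], the address of the first emitted
    instruction. The offset 2 in the exits counts the test before the body and the jump behind
    it. *)
Fixpoint code (s : stmt) (b : nat) : seq instr :=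
  match s with
  | Skip => [::]
  | Inc r => [:: INC (mreg r)]
  | Seq s t => let c := code s b in c ++ code t (b + size c)
  | Loop r s =>
      let c := code s b.+1 in
      DEC (mreg r) (b + (size c).+2) :: c ++ [:: DEC 1 b]
  | IfDec r s t =>
      let c := code s b.+1 in
      let d := code t (b + (size c).+2) in
      DEC (mreg r) (b + (size c).+2) ::
        c ++ DEC 1 (b + (size c + size d).+2) :: d
  end.

Definition agree (st regs : state) : Prop :=
  regs 1 = 0 /\ forall r, regs (mreg r) = st r.

Lemma mreg_neq1 r : (1 == mreg r) = false.
Proof. by case: r. Qed.

Lemma mreg_eq r r' : (mreg r == mreg r') = (r == r').
Proof. by case: r; case: r'. Qed.

Lemma agree_upd st regs r v :
  agree st regs -> agree (upd st r v) (upd regs (mreg r) v).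
Proof.
move=> [h1 h2]; split=> [|r']; rewrite /upd ?mreg_neq1 ?mreg_eq //.
by case: eqP.
Qed.

Definition code_at (p c : seq instr) (b : nat) : Prop :=
  forall i, i < size c -> List.nth_error p (b + i) = List.nth_error c i.

Lemma nth_error_cat (T : Type) (c d : seq T) i :
  List.nth_error (c ++ d) i =
  if i < size c then List.nth_error c i else List.nth_error d (i - size c).
Proof. by elim: c i => [|x c ih] [|i] //=; rewrite ih. Qed.

Lemma code_at_cat p c d b :
  code_at p (c ++ d) b -> code_at p c b /\ code_at p d (b + size c).
Proof.
move=> h; split=> i hi.
  by rewrite h ?nth_error_cat ?hi // size_cat ltn_addr.
rewrite -addnA h ?nth_error_cat; last by rewrite size_cat ltn_add2l.
by rewrite ltnNge leq_addr /= addKn.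
Qed.

Lemma code_at_cons p x c b :
  code_at p (x :: c) b -> List.nth_error p b = Some x /\ code_at p c b.+1.
Proof.
move=> h; split=> [|i hi]; first by rewrite -[b]addn0 h.
by rewrite addSnnS h.
Qed.

(** Phrased with halting continuations because [run] shows only the final output, never an
    intermediate configuration. *)
Definition resumes p b regs b' regs' : Prop :=
  forall f o, run p f b' regs' = Some o -> exists f', run p f' b regs = Some o.

Lemma resumes_jump p b b' regs : List.nth_error p b = Some (DEC 1 b') ->
  regs 1 = 0 -> resumes p b regs b' regs.
Proof. by move=> hp h0 f o hf; exists f.+1; rewrite /= hp h0. Qed.

(** Induction on the execution, not on the statement: after one round of a [Loop] the same code runs
    again at the same address, and the subderivation for the remaining rounds covers this. *)
Lemma code_correct p s st st' : exec s st st' ->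
  forall b regs, code_at p (code s b) b -> agree st regs ->
  exists2 regs', agree st' regs' &
    resumes p b regs (b + size (code s b)) regs'.
Proof.
elim=> {s st st'}
  [st|r st|s t st1 st2 st3 _ ihs _ iht|r s st h0|r s st1 st2 st3 h0 _ ihs _ ihl
  |r s t st1 st2 h0 _ ih|r s t st1 st2 h0 _ ih] b regs /=.
- by move=> _ h; exists regs => // f o; rewrite addn0; exists f.
- move=> /code_at_cons[hp _] h; exists (upd regs (mreg r) (st r).+1).
    exact: agree_upd.
  by move=> f o hf; exists f.+1; rewrite /= hp h.2 -addn1.
- move=> /code_at_cat[hs ht] /(ihs _ _ hs)[regs2] /(iht _ _ ht)[regs3 h3 r3 r2].
  by exists regs3 => // f o; rewrite size_cat addnA => /r3[f' /r2].
- move=> /code_at_cons[hp _] h; exists regs => // f o hf; exists f.+1.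
  by rewrite /= hp h.2 h0 /=; move: hf; rewrite size_cat addn1.
- move=> hc h; have := hc; move=> /code_at_cons[hp] /code_at_cat[hs].
  rewrite addSn => /code_at_cons[hj _].
  have [regs2 h2 r2] := ihs _ _ hs (agree_upd r (st1 r).-1 h).
  have [regs3 h3 r3] := ihl _ _ hc h2.
  exists regs3 => // f o /r3[f' /(resumes_jump hj h2.1)[f2]].
  rewrite -addSn => /r2[f3 h4]; exists f3.+1.
  by rewrite /= hp h.2; case: eqP.
- move=> /code_at_cons[hp] /code_at_cat[_] /code_at_cons[_].
  rewrite -addnS addSnnS => ht h.
  have [regs2 h2 r2] := ih _ _ ht h.
  exists regs2 => // f o hf; have [|f' hf'] := r2 f o.
    by move: hf; rewrite size_cat /=; congr (run _ _ _ _ = _); lia.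
  by exists f'.+1; rewrite /= hp h.2 h0 /=.
- move=> /code_at_cons[hp] /code_at_cat[hs]; rewrite addSn => /code_at_cons[hj _] h.
  have [regs2 h2 r2] := ih _ _ hs (agree_upd r (st1 r).-1 h).
  exists regs2 => // f o hf.
  have [|f1] := resumes_jump hj h2.1 (f := f) (o := o).
    by move: hf; rewrite size_cat /=; congr (run _ _ _ _ = _); lia.
  rewrite -addSn => /r2[f' hf']; exists f'.+1.
  by rewrite /= hp h.2; case: eqP.
Qed.

(** * Computable functions *)

Definition clean k (st : state) : Prop := forall j, k <= j -> st j = 0.

(* Scratch registers, those from k on, are zero before and after. *)
Definition comp1 (f : nat -> nat) : Prop :=
  forall i o k, i < k -> o < k -> exists s, forall st,
  clean k st -> exec s st (upd st o (f (st i))).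

Lemma comp1_halts f : comp1 f -> exists p, forall n, halts_with p n (f n).
Proof.
move=> /(_ 0 0 1 isT isT)[s hs]; exists (code s 0) => n.
pose st : state := fun i => if i == 0 then n else 0.
have hst : clean 1 st by case.
have hc : code_at (code s 0) (code s 0) 0 by [].
have hag : agree st st by split=> // -[].
have [regs' h' hr] := code_correct (hs _ hst) hc hag.
(* One unit of fuel suffices to notice that the program counter has left the program. *)
have [|fuel hf] := hr 1 (f n); last by exists fuel.
rewrite add0n /=; have -> : List.nth_error (code s 0) (size (code s 0)) = None.
  by elim: (code s 0).
by rewrite (h'.2 0).
Qed.

Lemma updE st r v j : upd st r v j = if j == r then v else st j.
Proof. by []. Qed.

Ltac upd_eq := apply/funext => j; rewrite !updE;
  repeat (case: eqP => ?); subst; try done; try contradiction; try lia.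

Lemma exec_clear r st : exec (Loop r Skip) st (upd st r 0).
Proof.
move e : (st r) => n; elim: n st e => [|n ih] st hn.
  have -> : upd st r 0 = st by upd_eq.
  exact: ExecLoop0.
apply: ExecLoopS; [by rewrite hn|exact: ExecSkip|].
rewrite hn /=; have := ih (upd st r n); rewrite updE eqxx => /(_ erefl).
by congr (exec _ _ _); upd_eq.
Qed.

Lemma exec_move r o st : r != o ->
  exec (Loop r (Inc o)) st (upd (upd st o (st o + st r)) r 0).
Proof.
move=> /eqP ro; move e : (st r) => n; elim: n st e => [|n ih] st hn.
  have -> : upd (upd st o (st o + 0)) r 0 = st by upd_eq.
  exact: ExecLoop0.
apply: ExecLoopS; [by rewrite hn|exact: ExecInc|].
rewrite hn /=; set st1 := upd _ _ _.
have /ih : st1 r = n by rewrite /st1 !updE; do !case: eqP.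
by congr (exec _ _ _); rewrite /st1; upd_eq.
Qed.

Lemma exec_move2 r o t st : r != o -> r != t -> o != t ->
  exec (Loop r (Seq (Inc o) (Inc t))) st
    (upd (upd (upd st o (st o + st r)) t (st t + st r)) r 0).
Proof.
move=> /eqP ro /eqP rt /eqP ot.
move e : (st r) => n; elim: n st e => [|n ih] st hn.
  have -> : upd (upd (upd st o (st o + 0)) t (st t + 0)) r 0 = st by upd_eq.
  exact: ExecLoop0.
apply: ExecLoopS; [by rewrite hn|apply: ExecSeq; exact: ExecInc|].
rewrite hn; set st1 := upd _ _ _.
have /ih : st1 r = n by rewrite /st1 !updE; do !case: eqP.
by congr (exec _ _ _); rewrite /st1; upd_eq.
Qed.

(** A register can be read only by draining it, so [i] is drained into both [o] and the scratch
    register [t], then refilled from [t]. *)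
Definition add_copy i o t := Seq (Loop i (Seq (Inc o) (Inc t))) (Loop t (Inc i)).

Lemma exec_add_copy i o t st : i != o -> i != t -> o != t -> st t = 0 ->
  exec (add_copy i o t) st (upd st o (st o + st i)).
Proof.
move=> io it ot h0; apply: ExecSeq; first exact: exec_move2.
set st1 := upd _ _ _; have := @exec_move t i st1; rewrite eq_sym => /(_ it).
move/eqP: io; move/eqP: it; move/eqP: ot => ot it io.
by congr (exec _ _ _); rewrite /st1; upd_eq.
Qed.

Lemma comp1_id : comp1 id.
Proof.
(* If [i] and [o] are the same register, clearing [o] would destroy the argument. *)
move=> i o k hi ho; have [->|io] := eqVneq i o.
  exists Skip => st _; have -> : upd st o (st o) = st by upd_eq.
  exact: ExecSkip.
exists (Seq (Loop o Skip) (add_copy i o k)) => st hst.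
apply: ExecSeq; first exact: exec_clear.
have := @exec_add_copy i o k (upd st o 0) io.
rewrite !updE eqxx (negPf io); have -> : (k == o) = false by lia.
move=> /(_ ltac:(lia) ltac:(lia) (hst _ (leqnn _))).
by congr (exec _ _ _); upd_eq.
Qed.

Lemma clean_updS k st v : clean k st -> clean k.+1 (upd st k v).
Proof. by move=> h j hj; rewrite updE; case: eqP => [|_]; [lia|apply: h; lia]. Qed.

Lemma clean_upd_lt k st r v : r < k -> clean k st -> clean k (upd st r v).
Proof. by move=> hr h j hj; rewrite updE; case: eqP => [|_]; [lia|apply: h; lia]. Qed.

Lemma clean_leq k k' st : k <= k' -> clean k st -> clean k' st.
Proof. by move=> hk h j hj; apply: h; lia. Qed.

Lemma comp1_const c : comp1 (fun=> c).
Proof.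
move=> i o k hi ho; elim: c => [|c [s hs]].
  by exists (Loop o Skip) => st _; exact: exec_clear.
exists (Seq s (Inc o)) => st hst; apply: ExecSeq; first exact: hs.
have := ExecInc o (upd st o c).
by congr (exec _ _ _); rewrite updE eqxx; upd_eq.
Qed.

(** Register [k] holds the intermediate value, so both programs take their scratch space from [k.+1]
    on, and [k] is cleared at the end. *)
Lemma comp1_comp f g : comp1 f -> comp1 g -> comp1 (fun x => g (f x)).
Proof.
move=> hf hg i o k hi ho.
have [s hs] := hf i k k.+1 ltac:(lia) ltac:(lia).
have [t ht] := hg k o k.+1 ltac:(lia) ltac:(lia).
exists (Seq s (Seq t (Loop k Skip))) => st hst.
apply: ExecSeq; first by apply: hs; apply: clean_leq hst.
apply: ExecSeq; first by apply: ht; apply: clean_updS.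
set st1 := upd _ _ _; have := exec_clear k st1; congr (exec _ _ _).
rewrite /st1 !updE eqxx; have := hst k (leqnn k); move=> hk.
by upd_eq.
Qed.

Lemma comp1_succ f : comp1 f -> comp1 (fun x => (f x).+1).
Proof.
move=> hf i o k hi ho; have [s hs] := hf i o k hi ho.
exists (Seq s (Inc o)) => st hst; apply: ExecSeq; first exact: hs.
have := ExecInc o (upd st o (f (st i))).
by congr (exec _ _ _); rewrite updE eqxx; upd_eq.
Qed.

(** * Cantor pairing on registers *)

Definition tri s := (s * s.+1)./2.

Lemma triS s : tri s.+1 = s.+1 + tri s.
Proof.
rewrite /tri; have -> : s.+1 * s.+2 = s.+1.*2 + s * s.+1 by lia.
by rewrite halfD odd_double add0n doubleK.
Qed.

Lemma cpairE a b : cpair a b = tri (a + b) + b.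
Proof. by []. Qed.

(** With a in [k] and b in [k.+1]: [o] receives b, [k] becomes a + b, and the last loop adds to [o]
    every value that [k] runs through, in total a triangular number. The body sees [k] already
    decremented, hence the extra [Inc o]; [k.+1] is empty by then and serves as scratch. *)
Definition pair_code k o :=
  Seq (Loop o Skip) (Seq (add_copy k.+1 o k.+2)
    (Seq (Loop k.+1 (Inc k)) (Loop k (Seq (Inc o) (add_copy k o k.+1))))).

Lemma exec_tri k o t st : k != o -> k != t -> o != t -> st t = 0 ->
  exec (Loop k (Seq (Inc o) (add_copy k o t))) st
    (upd (upd st o (st o + tri (st k))) k 0).
Proof.
move=> ko kt ot; move e : (st k) => n; elim: n st e => [|n ih] st hn h0.
  have -> : upd (upd st o (st o + tri 0)) k 0 = st by rewrite /tri; upd_eq.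
  exact: ExecLoop0.
apply: ExecLoopS; first by rewrite hn.
- apply: ExecSeq; first exact: ExecInc.
  apply: exec_add_copy => //; move/eqP: ko; move/eqP: kt; move/eqP: ot => ot kt ko.
  by rewrite !updE; repeat case: eqP => ? //; lia.
- rewrite triS hn /=; set st1 := upd _ _ _.
  move/eqP: ko; move/eqP: kt; move/eqP: ot => ot kt ko.
  have h1 : st1 k = n by rewrite /st1 !updE; repeat case: eqP => ? //; lia.
  have h2 : st1 t = 0 by rewrite /st1 !updE; repeat case: eqP => ? //; lia.
  move: (ih st1 h1 h2) => {h1 h2}; congr (exec _ _ _).
  by rewrite /st1; upd_eq.
Qed.

Lemma exec_pair k o st : o \notin [:: k; k.+1; k.+2] -> st k.+2 = 0 ->
  exec (pair_code k o) st
    (upd (upd (upd st o (cpair (st k) (st k.+1))) k 0) k.+1 0).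
Proof.
rewrite !inE !negb_or => /and3P[/eqP ok /eqP ok1 /eqP ok2] h0.
apply: ExecSeq; first exact: exec_clear.
apply: ExecSeq; first apply: exec_add_copy; try lia.
  by rewrite !updE; repeat case: eqP => ?; try lia.
apply: ExecSeq; first by apply: exec_move; lia.
set st2 := upd _ _ _.
have := @exec_tri k o k.+1 st2 ltac:(lia) ltac:(lia) ltac:(lia).
have -> : st2 k.+1 = 0 by rewrite /st2 updE eqxx.
have -> : st2 k = st k + st k.+1.
  by rewrite /st2 !updE; repeat case: eqP => ?; try lia.
have -> : st2 o = st k.+1.
  by rewrite /st2 !updE; repeat case: eqP => ?; try lia.
move=> /(_ erefl); congr (exec _ _ _).
by rewrite /st2 cpairE [tri _ + _]addnC; upd_eq.
Qed.

Lemma comp1_pair f g : comp1 f -> comp1 g -> comp1 (fun x => cpair (f x) (g x)).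
Proof.
move=> hf hg i o k hi ho.
have [s hs] := hf i k k.+1 ltac:(lia) ltac:(lia).
have [t ht] := hg i k.+1 k.+2 ltac:(lia) ltac:(lia).
exists (Seq s (Seq t (pair_code k o))) => st hst.
have hk : st k = 0 by apply: hst; lia.
have hk1 : st k.+1 = 0 by apply: hst; lia.
have hk2 : st k.+2 = 0 by apply: hst; lia.
apply: ExecSeq; first by apply: hs; apply: clean_leq hst.
apply: ExecSeq; first by apply: ht; apply: (@clean_leq k.+1) => //; exact: clean_updS.
have -> : upd st k (f (st i)) i = st i by rewrite updE; case: eqP => //; lia.
set st1 := upd _ _ _; have := @exec_pair k o st1.
have -> : st1 k = f (st i) by rewrite /st1 !updE; repeat case: eqP => ?; try lia.
have -> : st1 k.+1 = g (st i) by rewrite /st1 !updE; repeat case: eqP => ?; try lia.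
have -> : st1 k.+2 = 0 by rewrite /st1 !updE; repeat case: eqP => ?; try lia.
have -> : o \notin [:: k; k.+1; k.+2] by rewrite !inE; lia.
by move=> /(_ isT erefl); congr (exec _ _ _); rewrite /st1; upd_eq.
Qed.

(** Successor in the enumeration of pairs by [cpair]: along an antidiagonal, then on to the next
    one. Iterating it inverts [cpair] without square roots. *)
Definition next_pair (p : nat * nat) : nat * nat :=
  if p.1 is a.+1 then (a, p.2.+1) else (p.2.+1, 0).

Definition unpair n : nat * nat := iter n next_pair (0, 0).

Lemma cpair_next p : cpair (next_pair p).1 (next_pair p).2 = (cpair p.1 p.2).+1.
Proof.
case: p => [[|a] b]; rewrite /next_pair /= !cpairE.
  by rewrite !addn0 add0n triS addSn addnC.
by rewrite !addnS addSn addSn.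
Qed.

Lemma cpairK n : cpair (unpair n).1 (unpair n).2 = n.
Proof. by elim: n => // n ih; rewrite /unpair iterS cpair_next ih. Qed.

Lemma unpairK a b : unpair (cpair a b) = (a, b).
Proof.
move e : (cpair a b) => n; elim: n a b e => [|n ih] a b e.
  by case: a b e => [|a] [|b] //; rewrite cpairE // addSn triS.
(* The code is a successor, so the pair is not [(0, 0)] and has a predecessor. *)
have [p hp] : exists p, next_pair p = (a, b).
  case: b e => [|b] e; last by exists (a.+1, b).
  by case: a e => // a _; exists (0, a).
rewrite -hp; congr next_pair; case: p hp => a' b' hp; apply: ih.
by have := cpair_next (a', b'); rewrite hp /= e => -[].
Qed.

Lemma leq_cpair a b : b <= cpair a b.
Proof. exact: leq_addl. Qed.

Definition next_code k := IfDec k (Inc k.+1) (Seq (Inc k) (Loop k.+1 (Inc k))).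

Lemma exec_next k st :
  let p := next_pair (st k, st k.+1) in
  exec (next_code k) st (upd (upd st k p.1) k.+1 p.2).
Proof.
rewrite /next_pair /=; case e : (st k) => [|a] /=.
  apply: ExecIf0 => //; apply: ExecSeq; first exact: ExecInc.
  have := @exec_move k.+1 k (upd st k (st k).+1) ltac:(lia).
  by congr (exec _ _ _); upd_eq.
apply: ExecIfS; first by rewrite e.
have := ExecInc k.+1 (upd st k (st k).-1).
by congr (exec _ _ _); rewrite e; upd_eq.
Qed.

Lemma exec_unpair k st : st k = 0 -> st k.+1 = 0 ->
  let p := unpair (st k.+2) in
  exec (Loop k.+2 (next_code k)) st (upd (upd (upd st k p.1) k.+1 p.2) k.+2 0).
Proof.
move=> h0 h1 /=.
(* Loop invariant: [m] steps of the walk are done and [n] remain. *)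
suff h n m st1 : st1 k.+2 = n -> (st1 k, st1 k.+1) = iter m next_pair (0, 0) ->
    exec (Loop k.+2 (next_code k)) st1
      (upd (upd (upd st1 k (unpair (n + m)).1) k.+1 (unpair (n + m)).2) k.+2 0).
  by have := h (st k.+2) 0 st erefl; rewrite h0 h1 addn0 => /(_ erefl).
elim: n m st1 => [|n ih] m st1 hn hm.
  rewrite /unpair add0n -hm /=; set st2 := upd _ _ _.
  have -> : st2 = st1 by rewrite /st2; upd_eq.
  exact: ExecLoop0.
apply: ExecLoopS; [by rewrite hn|exact: exec_next|].
rewrite hn /= !updE; have -> : (k == k.+2) = false by lia.
have -> : (k.+1 == k.+2) = false by lia.
rewrite hm -iterS; have -> : next_pair (unpair (n + m)) = unpair (n + m.+1) by rewrite addnS.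
case e : (iter m.+1 next_pair (0, 0)) => [a b].
set st2 := upd _ _ _; have := ih m.+1 st2.
have -> : st2 k.+2 = n by rewrite /st2 !updE; repeat case: eqP => ?; try lia.
have -> : st2 k = a by rewrite /st2 !updE; repeat case: eqP => ?; try lia.
have -> : st2 k.+1 = b by rewrite /st2 !updE; repeat case: eqP => ?; try lia.
rewrite e => /(_ erefl erefl); congr (exec _ _ _).
by rewrite /st2; upd_eq.
Qed.

Lemma comp1_unpair (b : bool) :
  comp1 (fun n => if b then (unpair n).2 else (unpair n).1).
Proof.
move=> i o k hi ho.
have [s hs] := comp1_id (i := i) (o := k.+2) (k := k.+3) ltac:(lia) ltac:(lia).
exists (Seq s (Seq (Loop k.+2 (next_code k)) (Seq (Loop o Skip)
  (Seq (Loop (if b then k.+1 else k) (Inc o)) (Loop (if b then k else k.+1) Skip))))) => st hst.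
have hk : st k = 0 by apply: hst; lia.
have hk1 : st k.+1 = 0 by apply: hst; lia.
have hk2 : st k.+2 = 0 by apply: hst; lia.
apply: ExecSeq; first by apply: hs; apply: clean_leq hst; lia.
have := @exec_unpair k (upd st k.+2 (st i)); rewrite !updE eqxx.
have -> : (k == k.+2) = false by lia.
have -> : (k.+1 == k.+2) = false by lia.
move=> /(_ hk hk1) /= h; apply: ExecSeq; first exact: h.
apply: ExecSeq; first exact: exec_clear.
apply: ExecSeq; first by apply: exec_move; case: b; lia.
set st1 := upd _ _ _; have := exec_clear (if b then k else k.+1) st1.
by congr (exec _ _ _); rewrite /st1; case: b {st1}; upd_eq.
Qed.

(** The source of every later recursion. Register [k] is the counter and [k.+1] the current value;
    [k.+2] to [k.+4] serve to pair the parameter with that value, and the pair goes to [k + 5], the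
    input register of the program for [f]. *)
Lemma comp1_iter f n a : comp1 f -> comp1 n -> comp1 a ->
  comp1 (fun x => iter (n x) (fun y => f (cpair x y)) (a x)).
Proof.
move=> hf hn ha i o k hi ho.
have [s hs] := hn i k k.+1 ltac:(lia) ltac:(lia).
have [t ht] := ha i k.+1 k.+2 ltac:(lia) ltac:(lia).
have [u hu] := hf (k + 5) k.+1 (k + 6) ltac:(lia) ltac:(lia).
pose body := Seq (add_copy i k.+2 k.+4) (Seq (add_copy k.+1 k.+3 k.+4)
  (Seq (pair_code k.+2 (k + 5)) (Seq u (Loop (k + 5) Skip)))).
have hbody st : clean k.+2 st ->
    exec body st (upd st k.+1 (f (cpair (st i) (st k.+1)))).
  move=> hst.
  have hk2 : st k.+2 = 0 by apply: hst; lia.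
  have hk3 : st k.+3 = 0 by apply: hst; lia.
  have hk4 : st k.+4 = 0 by apply: hst; lia.
  have hk5 : st (k + 5) = 0 by apply: hst; lia.
  apply: ExecSeq; first by apply: exec_add_copy => //; lia.
  apply: ExecSeq; first apply: exec_add_copy; try lia.
    by rewrite updE; repeat case: eqP => ?; try lia.
  set st1 := upd _ _ _; have := @exec_pair k.+2 (k + 5) st1.
  have -> : st1 k.+2 = st i by rewrite /st1 !updE; repeat case: eqP => ?; try lia.
  have -> : st1 k.+3 = st k.+1 by rewrite /st1 !updE; repeat case: eqP => ?; try lia.
  have -> : st1 k.+4 = 0 by rewrite /st1 !updE; repeat case: eqP => ?; try lia.
  have -> : k + 5 \notin [:: k.+2; k.+3; k.+4] by rewrite !inE; lia.
  move=> /(_ isT erefl) h1; apply: ExecSeq; first exact: h1.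
  set st2 := upd _ _ _; apply: ExecSeq; first apply: hu.
    move=> j hj; rewrite /st2 /st1 !updE; repeat case: eqP => ?; try lia.
    by apply: hst; lia.
  have -> : st2 (k + 5) = cpair (st i) (st k.+1).
    by rewrite /st2 !updE; repeat case: eqP => ?; try lia.
  set st3 := upd _ _ _; have := exec_clear (k + 5) st3.
  by congr (exec _ _ _); rewrite /st3 /st2 /st1; upd_eq.
have hloop m st : clean k.+2 st -> st k = m -> exec (Loop k body) st
    (upd (upd st k 0) k.+1 (iter m (fun y => f (cpair (st i) y)) (st k.+1))).
  elim: m st => [|m ih] st hst hm.
    set st1 := upd _ _ _; have -> : st1 = st by rewrite /st1 /=; upd_eq.
    exact: ExecLoop0.
  apply: ExecLoopS; first by rewrite hm.
    by apply: hbody; apply: clean_upd_lt => //; lia.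
  rewrite hm /= !updE; have -> : (i == k) = false by lia.
  have -> : (k.+1 == k) = false by lia.
  set st1 := upd _ _ _; have := ih st1.
  have -> : st1 k = m by rewrite /st1 !updE; repeat case: eqP => ?; try lia.
  have -> : st1 i = st i by rewrite /st1 !updE; repeat case: eqP => ?; try lia.
  have -> : st1 k.+1 = f (cpair (st i) (st k.+1)).
    by rewrite /st1 !updE; repeat case: eqP => ?; try lia.
  have hst1 : clean k.+2 st1 by do 2!(apply: clean_upd_lt; first lia).
  move=> /(_ hst1 erefl); rewrite -iterSr /= ; clear hst1.
  by congr (exec _ _ _); rewrite /st1; upd_eq.
exists (Seq s (Seq t (Seq (Loop k body) (Seq (Loop o Skip) (Loop k.+1 (Inc o)))))).
move=> st hst.
have hk : st k = 0 by apply: hst; lia.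
have hk1 : st k.+1 = 0 by apply: hst; lia.
apply: ExecSeq; first by apply: hs; apply: clean_leq hst.
apply: ExecSeq; first by apply: ht; apply: (@clean_leq k.+1) => //; exact: clean_updS.
have -> : upd st k (n (st i)) i = st i by rewrite updE; case: eqP => //; lia.
set st1 := upd _ _ _; have := hloop (n (st i)) st1.
have hst1 : clean k.+2 st1 by do 2!apply: clean_updS.
have -> : st1 k = n (st i) by rewrite /st1 !updE; repeat case: eqP => ?; try lia.
have -> : st1 k.+1 = a (st i) by rewrite /st1 !updE; repeat case: eqP => ?; try lia.
have -> : st1 i = st i by rewrite /st1 !updE; repeat case: eqP => ?; try lia.
move=> /(_ hst1 erefl) {hst1} h1; apply: ExecSeq; first exact: h1.
apply: ExecSeq; first exact: exec_clear.
clear h1; set st2 := upd _ _ _; have := @exec_move k.+1 o st2 ltac:(lia).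
by congr (exec _ _ _); rewrite /st2 /st1; upd_eq.
Qed.

(** * Computability for encoded types *)

Class Enc (T : Type) := enc : T -> nat.

#[global] Instance nat_enc : Enc nat := id.
#[global] Instance bool_enc : Enc bool := nat_of_bool.
#[global] Instance prod_enc S T `{Enc S} `{Enc T} : Enc (S * T) :=
  fun p => cpair (enc p.1) (enc p.2).
#[global] Instance seq_enc T `{Enc T} : Enc (seq T) := fun l => enc_list (map enc l).

(** [g] is constrained on codes only, so an encoding need not be surjective, nor even injective;
    injectivity is asked for where equality is tested. *)
Variant computable {X Y : Type} `{Enc X} `{Enc Y} (f : X -> Y) : Prop :=
  Comp g of comp1 g & forall x, g (enc x) = enc (f x).

Section Closure.
Context {X : Type} `{Enc X}.

Lemma comp_id : computable (fun x : X => x).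
Proof. by exists id => //; exact: comp1_id. Qed.

Lemma comp_const Y `{Enc Y} (c : Y) : computable (fun _ : X => c).
Proof. by exists (fun=> enc c) => //; exact: comp1_const. Qed.

Lemma comp_comp Y Z `{Enc Y} `{Enc Z} (g : Y -> Z) (f : X -> Y) :
  computable g -> computable f -> computable (fun x => g (f x)).
Proof.
move=> [g' hg eg] [f' hf ef]; exists (fun n => g' (f' n)); first exact: comp1_comp.
by move=> x; rewrite ef eg.
Qed.

Lemma comp_pair Y Z `{Enc Y} `{Enc Z} (f : X -> Y) (g : X -> Z) :
  computable f -> computable g -> computable (fun x => (f x, g x)).
Proof.
move=> [f' hf ef] [g' hg eg]; exists (fun n => cpair (f' n) (g' n)).
  exact: comp1_pair.
by move=> x; rewrite ef eg.
Qed.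

Lemma comp_fst Y Z `{Enc Y} `{Enc Z} (f : X -> Y * Z) :
  computable f -> computable (fun x => (f x).1).
Proof.
move=> [f' hf ef]; exists (fun n => (unpair (f' n)).1).
  exact: comp1_comp hf (comp1_unpair false).
by move=> x; rewrite ef unpairK.
Qed.

Lemma comp_snd Y Z `{Enc Y} `{Enc Z} (f : X -> Y * Z) :
  computable f -> computable (fun x => (f x).2).
Proof.
move=> [f' hf ef]; exists (fun n => (unpair (f' n)).2).
  exact: comp1_comp hf (comp1_unpair true).
by move=> x; rewrite ef unpairK.
Qed.

Lemma comp_iter Y `{Enc Y} (n : X -> nat) (F : X -> Y -> Y) (a : X -> Y) :
  computable n -> computable (fun p : X * Y => F p.1 p.2) -> computable a ->
  computable (fun x => iter (n x) (F x) (a x)).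
Proof.
move=> [n' hn en] [f' hf ef] [a' ha ea].
exists (fun x => iter (n' x) (fun y => f' (cpair x y)) (a' x)).
  exact: comp1_iter.
move=> x; rewrite en ea -[enc (n x)]/(n x); elim: (n x) => //= k ->.
exact: (ef (x, _)).
Qed.

(** Only codes matter, so a function may be replaced by one between other types that acts alike on
    codes. This is how a boolean is used as a number, or an automaton as a list. *)
Lemma comp_retype X' Y Y' `{Enc X'} `{Enc Y} `{Enc Y'}
    (r : X -> X') (f' : X' -> Y') (f : X -> Y) :
  computable f' -> (forall x, enc (r x) = enc x) -> (forall x, enc (f' (r x)) = enc (f x)) ->
  computable f.
Proof. by move=> [g hg eg] hr hf; exists g => // x; rewrite -hr eg hf. Qed.

Lemma comp_enc Y `{Enc Y} (f : X -> Y) : computable f -> computable (fun x => enc (f x)).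
Proof. by move=> [g hg eg]; exists g. Qed.

Lemma comp_unpair (n : X -> nat) : computable n -> computable (fun x => unpair (n x)).
Proof. by move=> [g hg eg]; exists g => // x; rewrite eg /enc /prod_enc cpairK. Qed.

Lemma comp_succ (n : X -> nat) : computable n -> computable (fun x => (n x).+1).
Proof.
move=> [g hg eg]; exists (fun x => (g x).+1); first exact: comp1_succ.
by move=> x; rewrite eg.
Qed.

End Closure.

(** A conditional is an iteration of length 0 or 1 that starts from the else branch. *)
Lemma comp_if X Y `{Enc X} `{Enc Y} (b : X -> bool) (f g : X -> Y) :
  computable b -> computable f -> computable g -> computable (fun x => if b x then f x else g x).
Proof.
move=> hb hf hg.
have h : computable (fun x => iter (nat_of_bool (b x)) (fun _ => f x) (g x)).
  apply: comp_iter => //; first exact: (comp_retype (r := id) hb).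
  by apply: comp_comp => //; apply: comp_fst; exact: comp_id.
by apply: (comp_retype (r := id) h) => // x; case: (b x).
Qed.

Lemma comp_eq0 X `{Enc X} (n : X -> nat) : computable n -> computable (fun x => n x == 0).
Proof.
move=> hn; have h : computable (fun x => iter (n x) (fun _ => false) true).
  by apply: comp_iter => //; exact: comp_const.
by apply: (comp_retype (r := id) h) => // x; case: (n x).
Qed.

Lemma comp_negb X `{Enc X} (b : X -> bool) : computable b -> computable (fun x => ~~ b x).
Proof.
move=> hb; have h : computable (fun x => if b x then false else true).
  by apply: comp_if => //; exact: comp_const.
by apply: (comp_retype (r := id) h) => // x; case: (b x).
Qed.

Lemma comp_andb X `{Enc X} (b c : X -> bool) :
  computable b -> computable c -> computable (fun x => b x && c x).
Proof. by move=> hb hc; apply: comp_if => //; exact: comp_const. Qed.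

Lemma comp_orb X `{Enc X} (b c : X -> bool) :
  computable b -> computable c -> computable (fun x => b x || c x).
Proof. by move=> hb hc; apply: comp_if => //; exact: comp_const. Qed.

Section Arith.
Context {X : Type} `{Enc X} (m n : X -> nat) (hm : computable m) (hn : computable n).

Lemma comp_pred : computable (fun x => (n x).-1).
Proof.
have h : computable (fun x => (iter (n x) (fun p : nat * nat => (p.2, p.2.+1)) (0, 0)).1).
  apply: comp_fst; apply: comp_iter => //; last exact: comp_const.
  apply: comp_pair; last apply: comp_succ; do 2!apply: comp_snd; exact: comp_id.
apply: (comp_retype (r := id) h) => // x; congr enc.
suff -> k : iter k (fun p : nat * nat => (p.2, p.2.+1)) (0, 0) = (k.-1, k) by [].
by elim: k => //= k ->.
Qed.

Lemma comp_addn : computable (fun x => m x + n x).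
Proof.
have h : computable (fun x => iter (m x) (fun p : nat => p.+1) (n x)).
  by apply: comp_iter => //; apply: comp_succ; apply: comp_snd; exact: comp_id.
by apply: (comp_retype (r := id) h) => // x; rewrite iter_succn addnC.
Qed.

End Arith.

Lemma comp_subn X `{Enc X} (m n : X -> nat) :
  computable m -> computable n -> computable (fun x => m x - n x).
Proof.
move=> hm hn; have h : computable (fun x => iter (n x) (fun p : nat => p.-1) (m x)).
  by apply: comp_iter => //; apply: comp_pred; apply: comp_snd; exact: comp_id.
apply: (comp_retype (r := id) h) => // x; congr enc.
by elim: (n x) => [|k /= ->]; rewrite ?subn0 ?subnS.
Qed.

Lemma comp_muln X `{Enc X} (m n : X -> nat) :
  computable m -> computable n -> computable (fun x => m x * n x).
Proof.
move=> hm hn; have h : computable (fun x => iter (m x) (fun p : nat => n x + p) 0).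
  apply: comp_iter => //; last exact: comp_const.
  apply: comp_addn; last by apply: comp_snd; exact: comp_id.
  by apply: comp_comp => //; apply: comp_fst; exact: comp_id.
by apply: (comp_retype (r := id) h) => // x; rewrite iter_addn_0 mulnC.
Qed.

Lemma comp_expn2 X `{Enc X} (n : X -> nat) : computable n -> computable (fun x => 2 ^ n x).
Proof.
move=> hn; have h : computable (fun x => iter (n x) (fun p : nat => p + p) 1).
  apply: comp_iter => //; last exact: comp_const.
  by apply: comp_addn; apply: comp_snd; exact: comp_id.
apply: (comp_retype (r := id) h) => // x; congr enc.
by elim: (n x) => //= k ->; rewrite expnS mul2n addnn.
Qed.

Lemma comp_leq X `{Enc X} (m n : X -> nat) :
  computable m -> computable n -> computable (fun x => m x <= n x).
Proof. by move=> hm hn; apply: comp_eq0; exact: comp_subn. Qed.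

Lemma comp_eq X (T : eqType) `{Enc X} `{Enc T} (f g : X -> T) :
  injective (@enc T _) -> computable f -> computable g -> computable (fun x => f x == g x).
Proof.
move=> inj hf hg.
have h : computable (fun x => (enc (f x) <= enc (g x)) && (enc (g x) <= enc (f x))).
  have hf' := comp_enc hf; have hg' := comp_enc hg.
  by apply: comp_andb; apply: comp_leq.
by apply: (comp_retype (r := id) h) => // x; rewrite -eqn_leq (inj_eq inj).
Qed.

Lemma comp_odd_half X `{Enc X} (n : X -> nat) :
  computable n -> computable (fun x => (odd (n x), (n x)./2)).
Proof.
move=> hn; have h : computable (fun x => iter (n x)
    (fun p : bool * nat => (~~ p.1, if p.1 then p.2.+1 else p.2)) (false, 0)).
  apply: comp_iter => //; last exact: comp_const.
  have h1 : computable (fun p : X * (bool * nat) => p.2.1).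
    by apply: comp_fst; apply: comp_snd; exact: comp_id.
  have h2 : computable (fun p : X * (bool * nat) => p.2.2).
    by apply: comp_snd; apply: comp_snd; exact: comp_id.
  by apply: comp_pair; [apply: comp_negb|apply: comp_if => //; exact: comp_succ].
apply: (comp_retype (r := id) h) => // x; congr enc.
by elim: (n x) => //= k ->; rewrite uphalf_half; case: odd.
Qed.

Lemma size_enc_list s : size s <= enc_list s.
Proof. by elim: s => //= x s ih; rewrite ltnS (leq_trans ih) // leq_cpair. Qed.

Lemma enc_cons T `{Enc T} (x : T) l : enc (x :: l) = (cpair (enc x) (enc l)).+1.
Proof. by []. Qed.

Lemma comp_cons X T `{Enc X} `{Enc T} (f : X -> T) (l : X -> seq T) :
  computable f -> computable l -> computable (fun x => f x :: l x).
Proof.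
move=> hf hl; have h : computable (fun x => (cpair (enc (f x)) (enc (l x))).+1).
  by apply: comp_succ; exact: comp_enc (comp_pair hf hl).
exact: (comp_retype (r := id) h).
Qed.

Section Lists.
Context {X T : Type} `{Enc X} `{Enc T}.

Lemma comp_foldl Y `{Enc Y} (F : X -> Y -> T -> Y) (a : X -> Y) (l : X -> seq T) :
  computable (fun p : X * (T * Y) => F p.1 p.2.2 p.2.1) -> computable a -> computable l ->
  computable (fun x => foldl (F x) (a x) (l x)).
Proof.
move=> [f hf ef] ha hl.
have cf : computable f by exists f.
pose step (x : nat) (s : nat * nat) : nat * nat :=
  if s.1 == 0 then s else
  let u := unpair s.1.-1 in (u.2, f (cpair x (cpair u.1 s.2))).
have cstep : computable (fun p : X * (nat * nat) => step (enc p.1) p.2).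
  have c2 : computable (fun p : X * (nat * nat) => p.2) by apply: comp_snd; exact: comp_id.
  have cu : computable (fun p : X * (nat * nat) => unpair p.2.1.-1).
    by apply: comp_unpair; apply: comp_pred; exact: comp_fst.
  apply: comp_if => //; first by apply: comp_eq0; exact: comp_fst.
  apply: comp_pair; first exact: comp_snd.
  apply: comp_comp => //; apply: (comp_retype (r := id)
    (f' := fun p : X * (nat * nat) => (p.1, ((unpair p.2.1.-1).1, p.2.2)))) => //.
  apply: comp_pair; first by apply: comp_fst; exact: comp_id.
  by apply: comp_pair; [exact: comp_fst|exact: comp_snd].
have h : computable (fun x => (iter (enc (l x)) (step (enc x)) (enc (l x), enc (a x))).2).
  have cl := comp_enc hl.
  apply: comp_snd; apply: comp_iter => //; apply: comp_pair => //.
  exact: comp_enc.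
apply: (comp_retype (r := id) h) => // x.
assert (h1 : forall (s : seq T) (b : Y) (n : nat), size s <= n ->
    iter n (step (enc x)) (enc s, enc b) = (0, enc (foldl (F x) b s))).
  elim=> [|e s ih] b n; first by move=> _; elim: n => //= n ->.
  case: n => // n hn; rewrite iterSr enc_cons /step /= unpairK /= -/step.
  by rewrite -(ih _ n) //; congr (iter _ _ (_, _)); exact: (ef (x, (e, b))).
rewrite h1 //; rewrite -(size_map enc); exact: size_enc_list.
Qed.

Lemma comp_rev (l : X -> seq T) : computable l -> computable (fun x => rev (l x)).
Proof.
move=> hl; have h : computable (fun x => foldl (fun s e => e :: s) [::] (l x)).
  apply: comp_foldl => //; last exact: comp_const.
  by apply: comp_cons; [apply: comp_fst|apply: comp_snd]; apply: comp_snd; exact: comp_id.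
apply: (comp_retype (r := id) h) => // x; congr enc.
rewrite -[RHS]cats0 -catrevE; elim: (l x) [::] => //= e s ih r; exact: ih.
Qed.

Lemma comp_foldr Y `{Enc Y} (F : X -> T -> Y -> Y) (a : X -> Y) (l : X -> seq T) :
  computable (fun p : X * (T * Y) => F p.1 p.2.1 p.2.2) -> computable a -> computable l ->
  computable (fun x => foldr (F x) (a x) (l x)).
Proof.
move=> hF ha hl.
have h : computable (fun x => foldl (fun y e => F x e y) (a x) (rev (l x))).
  by apply: comp_foldl => //; exact: comp_rev.
by apply: (comp_retype (r := id) h) => // x; rewrite -foldl_rev.
Qed.

End Lists.

Ltac cvar := repeat first [exact: comp_id | apply: comp_fst | apply: comp_snd].

Lemma comp_cat X T `{Enc X} `{Enc T} (l l' : X -> seq T) : computable l -> computable l' -> computable (fun x => l x ++ l' x).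
Proof.
move=> hl hl'; have h : computable (fun x => foldr cons (l' x) (l x)).
  by apply: comp_foldr => //; apply: comp_cons; cvar.
apply: (comp_retype (r := id) h) => // x; congr enc; by elim: (l x) => //= e s ->.
Qed.

Section Lists2.
Context {X T : Type} `{Enc X} `{Enc T}.

Lemma comp_map Y `{Enc Y} (F : X -> T -> Y) (l : X -> seq T) :
  computable (fun p : X * T => F p.1 p.2) -> computable l -> computable (fun x => map (F x) (l x)).
Proof.
move=> hF hl; have h : computable (fun x => foldr (fun e r => F x e :: r) [::] (l x)).
  apply: comp_foldr => //; last exact: comp_const.
  apply: comp_cons; last by cvar.
  by apply: (comp_comp (f := fun p : X * (T * _) => (p.1, p.2.1)) hF); apply: comp_pair; cvar.
apply: (comp_retype (r := id) h) => // x; congr enc; by elim: (l x) => //= e s ->.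
Qed.

Lemma comp_has (F : X -> T -> bool) (l : X -> seq T) :
  computable (fun p : X * T => F p.1 p.2) -> computable l -> computable (fun x => has (F x) (l x)).
Proof.
move=> hF hl; have h : computable (fun x => foldr (fun e r => F x e || r) false (l x)).
  apply: comp_foldr => //; last exact: comp_const.
  apply: comp_orb; last by cvar.
  by apply: (comp_comp (f := fun p : X * (T * _) => (p.1, p.2.1)) hF); apply: comp_pair; cvar.
apply: (comp_retype (r := id) h) => // x; congr enc; by elim: (l x) => //= e s ->.
Qed.

Lemma comp_all (F : X -> T -> bool) (l : X -> seq T) :
  computable (fun p : X * T => F p.1 p.2) -> computable l -> computable (fun x => all (F x) (l x)).
Proof.
move=> hF hl; have h : computable (fun x => ~~ has (fun e => ~~ F x e) (l x)).
  by apply: comp_negb; apply: comp_has => //; exact: comp_negb.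
by apply: (comp_retype (r := id) h) => // x; rewrite has_predC negbK.
Qed.

Lemma comp_size (l : X -> seq T) : computable l -> computable (fun x => size (l x)).
Proof.
move=> hl; have h : computable (fun x => foldr (fun _ r => r.+1) 0 (l x)).
  by apply: comp_foldr => //; [apply: comp_succ; cvar|exact: comp_const].
apply: (comp_retype (r := id) h) => // x; congr enc; by elim: (l x) => //= e s ->.
Qed.

Lemma comp_behead (l : X -> seq T) : computable l -> computable (fun x => behead (l x)).
Proof.
move=> hl.
have h : computable (fun x => (foldr (fun e p => (e :: p.1, p.1)) ([::], [::]) (l x)).2).
  apply: comp_snd; apply: comp_foldr => //; last exact: comp_const.
  by apply: comp_pair; first apply: comp_cons; cvar.
apply: (comp_retype (r := id) h) => // x; congr enc.
case: (l x) => //= _ s; by elim: s => //= e s ->.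
Qed.

End Lists2.

Lemma comp_nth X T `{Enc X} `{Enc T} x0 (l : X -> seq T) n :
  computable l -> computable n -> computable (fun x => nth x0 (l x) (n x)).
Proof.
move=> hl hn.
have h : computable (fun x => foldr (fun e _ => e) x0 (iter (n x) behead (l x))).
  apply: comp_foldr; [by cvar|exact: comp_const|].
  by apply: comp_iter => //; apply: comp_behead; cvar.
apply: (comp_retype (r := id) h) => // x; congr enc.
elim: (n x) (l x) => [|k ih] [|e s] //; rewrite ?iterSr /= ?ih //.
by rewrite nth_nil.
Qed.

Lemma comp_flatten X T `{Enc X} `{Enc T} (l : X -> seq (seq T)) :
  computable l -> computable (fun x => flatten (l x)).
Proof. by move=> hl; apply: comp_foldr => //; [apply: comp_cat; cvar|exact: comp_const]. Qed.

Lemma comp_iota0 X `{Enc X} (n : X -> nat) : computable n -> computable (fun x => iota 0 (n x)).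
Proof.
move=> hn; have h : computable (fun x => iter (n x) (fun s => s ++ [:: size s]) [::]).
  apply: comp_iter => //; last exact: comp_const.
  apply: comp_cat; first by cvar.
  by apply: comp_cons; [apply: comp_size; cvar|exact: comp_const].
apply: (comp_retype (r := id) h) => // x; congr enc.
by elim: (n x) => // k; rewrite iterS => ->; rewrite size_iota -addn1 iotaD.
Qed.

Lemma cpair_inj a b a' b' : cpair a b = cpair a' b' -> (a, b) = (a', b').
Proof. by move=> e; rewrite -(unpairK a b) e unpairK. Qed.

Lemma prod_enc_inj S T `{Enc S} `{Enc T} :
  injective (@enc S _) -> injective (@enc T _) -> injective (@enc (S * T) _).
Proof. by move=> hS hT [a b] [a' b'] /cpair_inj[/hS -> /hT ->]. Qed.

Lemma nat_enc_inj : injective (@enc nat _). Proof. by []. Qed.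

Lemma bool_enc_inj : injective (@enc bool _). Proof. by case=> [] []. Qed.

(** * Weights and automata as encoded data *)

Import Order.TTheory GRing.Theory Num.Theory.

#[global] Instance qbar_enc : Enc qbar := enc_qbar.

Lemma enc_int_inj : injective enc_int.
Proof. by case=> m [] n /= h; try lia; congr (_ _); lia. Qed.

Lemma qbar_enc_inj : injective (@enc qbar _).
Proof.
move=> [p| |] [q| |] //=; rewrite /enc /= => -[] /cpair_inj[/enc_int_inj hn /enc_int_inj hd].
by congr EFin; apply/eqP; rewrite rat_eqE hn hd !eqxx.
Qed.

Definition lt_frac_code (z d z' d' : nat) : bool :=
  if odd z then if odd z' then z'./2.+1 * d./2 < z./2.+1 * d'./2 else true
  else if odd z' then false else z./2 * d'./2 < z'./2 * d./2.

Definition lt_code (c c' : nat) : bool :=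
  if c' == 0 then false else if c == 0 then true else
  if c == 1 then false else if c' == 1 then true else
  lt_frac_code (unpair c.-1.-1).1 (unpair c.-1.-1).2
               (unpair c'.-1.-1).1 (unpair c'.-1.-1).2.

Lemma lt_frac_codeE (a b : int) (p q : nat) : 0 < p -> 0 < q ->
  lt_frac_code (enc_int a) p.*2 (enc_int b) q.*2 = (a * Posz q < b * Posz p)%R.
Proof.
rewrite /lt_frac_code !doubleK.
case: a b => [m|m] [n|n] hp hq; rewrite /= ?odd_double ?uphalf_double ?doubleK /=.
- by lia.
- by apply/esym/negbTE; rewrite -leNgt; nia.
- by apply/esym; nia.
- by apply/idP/idP; nia.
Qed.

Lemma lt_codeE (x y : qbar) : lt_code (enc x) (enc y) = (x < y)%E.
Proof.
case: x y => [p| |] [q| |] //=; rewrite ?ltry ?ltNyr // lte_fin.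
rewrite /lt_code /enc /qbar_enc /enc_qbar /= !unpairK.
have [d hd] := denqP p; have [e he] := denqP q.
by rewrite hd he lt_frac_codeE // -he -hd -lt_ratE.
Qed.

Section CompWeight.
Context {X : Type} `{Enc X}.

Lemma comp_lt_frac_code (a b c d : X -> nat) :
  computable a -> computable b -> computable c -> computable d ->
  computable (fun x => lt_frac_code (a x) (b x) (c x) (d x)).
Proof.
move=> ha hb hc hd.
have half (f : X -> nat) : computable f -> computable (fun x => (f x)./2).
  by move=> /comp_odd_half/comp_snd.
have odd' (f : X -> nat) : computable f -> computable (fun x => odd (f x)).
  by move=> /comp_odd_half/comp_fst.
rewrite /lt_frac_code.
apply: comp_if; [exact: odd'| |]; (apply: comp_if; [exact: odd'| |]).
- by apply: comp_leq; first apply: comp_succ; apply: comp_muln; try apply: comp_succ; exact: half.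
- exact: comp_const.
- exact: comp_const.
- by apply: comp_leq; first apply: comp_succ; apply: comp_muln; exact: half.
Qed.

Lemma comp_eqn (m : X -> nat) c : computable m -> computable (fun x => m x == c).
Proof. by move=> hm; apply: comp_eq => //; exact: comp_const. Qed.

Lemma comp_lt (f g : X -> qbar) : computable f -> computable g -> computable (fun x => f x < g x)%E.
Proof.
move=> /comp_enc hf /comp_enc hg.
have h : computable (fun x => lt_code (enc (f x)) (enc (g x))).
  rewrite /lt_code; apply: comp_if; [exact: comp_eqn|exact: comp_const|].
  apply: comp_if; [exact: comp_eqn|exact: comp_const|].
  apply: comp_if; [exact: comp_eqn|exact: comp_const|].
  apply: comp_if; [exact: comp_eqn|exact: comp_const|].
  by apply: comp_lt_frac_code; (apply: comp_fst || apply: comp_snd);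
    apply: comp_unpair; do 2!apply: comp_pred.
by apply: (comp_retype (r := id) h) => // x; rewrite lt_codeE.
Qed.

End CompWeight.

Lemma nth_allpairs (S T R : Type) (f : S -> T -> R) s t i j x0 y0 z0 :
  i < size s -> j < size t ->
  nth z0 [seq f x y | x <- s, y <- t] (i * size t + j) = f (nth x0 s i) (nth y0 t j).
Proof.
move=> + hj; elim: s i => // x s ih [|i] hi /=; rewrite nth_cat size_map.
  by rewrite hj (nth_map y0).
rewrite mulSn -addnA ltnNge leq_addr /= addKn; exact: ih.
Qed.

Lemma enum_prod (S T : finType) :
  enum {: S * T} = [seq (x, y) | x <- enum S, y <- enum T].
Proof. by rewrite [LHS]enumT [in LHS]unlock. Qed.

Section Automaton.
Variable A : finType.
Implicit Type N : wba A.

#[local] Instance letter_enc : Enc A | 100 := fun a => enum_rank a : nat.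
#[local] Instance wba_enc : Enc (wba A) := enc_wba.

Definition wba_code N : seq nat :=
  nstates N ::
    [seq enc_qbar (wt N t) | t <- enum {: 'I_(nstates N) * A * 'I_(nstates N)}] ++
    [seq nat_of_bool (s \in init N) | s <- enum 'I_(nstates N)] ++
    [seq nat_of_bool (s \in fin N) | s <- enum 'I_(nstates N)].

(* The full set in [enc_wba] is a classical set, with membership in [Prop]. *)
Lemma enc_wbaE N : enc_wba N = enc_list (wba_code N).
Proof.
rewrite /enc_wba /wba_code; congr (enc_list (_ :: map _ _ ++ _)).
by apply: eq_enum => t; rewrite !inE; apply/asboolP.
Qed.

Definition weight N (p : nat) (a : A) (q : nat) : qbar :=
  if (insub p, insub q) is (Some p', Some q') then wt N (p', a, q') else -oo%E.

Definition is_init N (p : nat) : bool :=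
  if insub p is Some p' then p' \in init N else false.

Definition is_fin N (p : nat) : bool :=
  if insub p is Some p' then p' \in fin N else false.

Lemma weightE N (p q : 'I_(nstates N)) a : weight N p a q = wt N (p, a, q).
Proof. by rewrite /weight !valK. Qed.

Lemma is_initE N (p : 'I_(nstates N)) : is_init N p = (p \in init N).
Proof. by rewrite /is_init valK. Qed.

Lemma is_finE N (p : 'I_(nstates N)) : is_fin N p = (p \in fin N).
Proof. by rewrite /is_fin valK. Qed.

Lemma size_triples n : size (enum {: 'I_n * A * 'I_n}) = n * #|A| * n.
Proof. by rewrite -cardE !card_prod card_ord. Qed.

Lemma nth_triples n (p q : 'I_n) a :
  nth (p, a, q) (enum {: 'I_n * A * 'I_n})
    ((p * #|A| + enum_rank a) * n + q) = (p, a, q).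
Proof.
have hA : size (enum A) = #|A| by rewrite -cardE.
have hn : size (enum 'I_n) = n by rewrite size_enum_ord.
rewrite enum_prod.
have -> : (p * #|A| + enum_rank a) * n + q =
    (p * #|A| + enum_rank a) * size (enum 'I_n) + q by rewrite hn.
rewrite (nth_allpairs _ (p, a) q); first last.
- by rewrite hn.
- rewrite -cardE card_prod card_ord; have := ltn_ord p; have := ltn_ord (enum_rank a).
  by move: (#|A|) (nat_of_ord _) (nat_of_ord _) => k i j hi hj; nia.
rewrite nth_ord_enum; congr (_, _).
rewrite enum_prod.
have -> : p * #|A| + enum_rank a = p * size (enum A) + enum_rank a by rewrite hA.
by rewrite (nth_allpairs _ p a) ?nth_ord_enum ?nth_enum_rank ?hn // hA ltn_ord.
Qed.

Section Comp.
Context {X : Type} `{Enc X} (N : X -> wba A) (hN : computable N).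

Lemma comp_wba_code : computable (fun x => wba_code (N x)).
Proof.
apply: (comp_retype (r := id) hN) => // x.
by rewrite [LHS]enc_wbaE [RHS]/enc /seq_enc (@map_id nat).
Qed.

Lemma comp_nstates : computable (fun x => nstates (N x)).
Proof.
have h : computable (fun x => nth 0 (wba_code (N x)) 0).
  by apply: comp_nth; [exact: comp_wba_code|exact: comp_const].
exact: (comp_retype (r := id) h).
Qed.

Lemma comp_weight p a q : computable p -> computable a -> computable q ->
  computable (fun x => weight (N x) (p x) (a x) (q x)).
Proof.
move=> hp /comp_enc ha hq; have hn := comp_nstates.
have h : computable (fun x => if (p x < nstates (N x)) && (q x < nstates (N x)) then
    nth 0 (wba_code (N x)) ((p x * #|A| + enc (a x)) * nstates (N x) + q x).+1 else 0).
  apply: comp_if; last exact: comp_const.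
    by apply: comp_andb; apply: comp_leq => //; exact: comp_succ.
  apply: comp_nth; first exact: comp_wba_code.
  apply: comp_succ; apply: comp_addn => //; apply: comp_muln => //.
  by apply: comp_addn => //; apply: comp_muln => //; exact: comp_const.
apply: (comp_retype (r := id) h) => // x; rewrite -[id x]/x.
case: ltnP => /= [lp|gp]; last by rewrite /weight insubF //; lia.
case: ltnP => /= [lq|gq]; last by rewrite /weight [insub (q x)]insubF; [case: insub|lia].
set i := (_ * nstates _ + _)%N.
have hi : i < nstates (N x) * #|A| * nstates (N x).
  rewrite /i; have := ltn_ord (enum_rank (a x)); rewrite /enc /letter_enc.
  by move: (#|A|) (nat_of_ord _) (nstates _) lp lq => k r n lp lq; nia.
pose p' := Ordinal lp; pose q' := Ordinal lq.
rewrite -[weight _ _ _ _]/(weight (N x) p' (a x) q') weightE.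
rewrite nth_cat size_map size_triples hi (nth_map (p', a x, q')) ?size_triples //.
by rewrite (nth_triples p' q').
Qed.

Let comp_bit (p : X -> nat) b0 : computable p ->
  computable (fun x => (p x < nstates (N x)) &&
    (nth 0 (wba_code (N x)) (nstates (N x) * #|A| * nstates (N x) +
       (if b0 then nstates (N x) else 0) + p x).+1 == 1)).
Proof.
move=> hp; have hn := comp_nstates.
apply: comp_andb; first by apply: comp_leq => //; exact: comp_succ.
apply: comp_eqn; apply: comp_nth; first exact: comp_wba_code.
apply: comp_succ; apply: comp_addn => //; apply: comp_addn.
  by apply: comp_muln => //; apply: comp_muln => //; exact: comp_const.
by apply: comp_if => //; exact: comp_const.
Qed.

Lemma comp_is_init p : computable p -> computable (fun x => is_init (N x) (p x)).
Proof.
move=> hp; apply: (comp_retype (r := id) (comp_bit false hp)) => // x; congr enc.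
rewrite -[id x]/x; case: ltnP => /= [lp|gp]; last by rewrite /is_init insubF //; lia.
rewrite -[is_init _ _]/(is_init (N x) (Ordinal lp)) is_initE addn0 nth_cat size_map size_triples ltnNge leq_addr /= addKn.
rewrite nth_cat size_map size_enum_ord lp (nth_map (Ordinal lp)) ?size_enum_ord //.
by rewrite -[X in nth _ _ X]/(nat_of_ord (Ordinal lp)) nth_ord_enum; case: (_ \in _).
Qed.

Lemma comp_is_fin p : computable p -> computable (fun x => is_fin (N x) (p x)).
Proof.
move=> hp; apply: (comp_retype (r := id) (comp_bit true hp)) => // x; congr enc.
rewrite -[id x]/x; case: ltnP => /= [lp|gp]; last by rewrite /is_fin insubF //; lia.
rewrite -[is_fin _ _]/(is_fin (N x) (Ordinal lp)) is_finE -addnA nth_cat size_map size_triples ltnNge leq_addr /= addKn.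
rewrite nth_cat size_map size_enum_ord ltnNge leq_addr /= addKn.
rewrite (nth_map (Ordinal lp)) ?size_enum_ord //.
by rewrite -[X in nth _ _ X]/(nat_of_ord (Ordinal lp)) nth_ord_enum; case: (_ \in _).
Qed.

End Comp.
End Automaton.

(** * Weights of finite blocks and of ultimately constant block sequences *)

Section Weights.
Variable R : realDomainType.
Implicit Types (x y z : \bar R) (K : Ksel) (l : seq (\bar R)).
Local Open Scope ereal_scope.

Definition better K x y : bool := if K is K1 then x < y else y < x.

(* min (for K1) or max, with +oo neutral and -oo absorbing *)
Definition opw K x y : \bar R :=
  if (x == -oo) || (y == -oo) then -oo else
  if x == +oo then y else if y == +oo then x else
  if better K x y then x else y.

(* The value of a prefix of weight x followed by infinitely many blocks of weight y. *)
Definition lasso_val K x y : \bar R :=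
  if (x == -oo) || (y == -oo) then -oo else
  if K is K3 then opw K x y else if y == +oo then x else y.

Definition block_weight K l : \bar R := foldr (opw K) +oo l.

Lemma opwyx K x : opw K +oo x = x.
Proof. by rewrite /opw /=; case: eqP. Qed.

Lemma opwxy K x : opw K x +oo = x.
Proof. by rewrite /opw orbF; case: x. Qed.

Lemma opw_eqNy K x y : (opw K x y == -oo) = (x == -oo) || (y == -oo).
Proof.
rewrite /opw; case: (eqVneq x -oo) => //= hx; case: (eqVneq y -oo) => //= hy.
by do !case: ifP => _; apply/negbTE.
Qed.

Lemma opwxNy K x : opw K x -oo = -oo.
Proof. by apply/eqP; rewrite opw_eqNy eqxx orbT. Qed.

Lemma opw_eqy K x y : (opw K x y == +oo) = (x == +oo) && (y == +oo).
Proof.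
rewrite /opw; case: (eqVneq x -oo) => [->|hx] //=.
case: (eqVneq y -oo) => [->|hy] /=; first by rewrite andbF.
case: (eqVneq x +oo) => //= hx'; case: (eqVneq y +oo) => [_|hy']; rewrite ?(negPf hx') //.
by case: ifP => _; apply/negbTE.
Qed.

Lemma opw_either K x y : opw K x y = x \/ opw K x y = y.
Proof.
rewrite /opw; case: (eqVneq x -oo) => [->|hx] /=; first by left.
case: (eqVneq y -oo) => [->|hy] /=; first by right.
by do !case: ifP => _; auto.
Qed.

Lemma better_trans K x y z : better K x y -> better K y z -> better K x z.
Proof. by case: K => h1 h2; apply: lt_trans; eauto. Qed.

Lemma better_total K x y : ~~ better K x y -> ~~ better K y x -> x = y.
Proof. by case: K; rewrite /better -!leNgt => h1 h2; apply/le_anti/andP. Qed.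

Lemma opwA K : associative (opw K).
Proof.
move=> x y z.
have [->|hx] := eqVneq x -oo; first by rewrite /opw /=.
have [->|hy] := eqVneq y -oo; first by rewrite /opw /= orbT.
have [->|hz] := eqVneq z -oo; first by rewrite !opwxNy.
have [->|hx'] := eqVneq x +oo; first by rewrite !opwyx.
have [->|hy'] := eqVneq y +oo; first by rewrite opwyx opwxy.
have [->|hz'] := eqVneq z +oo; first by rewrite !opwxy.
have opE u v : u != -oo -> v != -oo -> u != +oo -> v != +oo ->
    opw K u v = if better K u v then u else v.
  by rewrite /opw => /negPf -> /negPf -> /negPf -> /negPf ->.
rewrite (opE y z) // (opE x y) //.
case: (boolP (better K y z)) => yz; case: (boolP (better K x y)) => xy; rewrite !opE //.
- by rewrite xy (better_trans xy yz).
- by rewrite (negPf xy) yz.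
- rewrite (negPf yz); case: ifP => // xz.
  have [zy|zy] := boolP (better K z y); first by rewrite (better_trans xz zy) in xy.
  by rewrite (better_total yz zy) xz in xy.
Qed.

Lemma block_weight_cat K l l' :
  block_weight K (l ++ l') = opw K (block_weight K l) (block_weight K l').
Proof. by elim: l => [|x l ih] /=; rewrite ?opwyx // ih opwA. Qed.

Lemma block_weight_eqNy K l : (block_weight K l == -oo) = (-oo \in l).
Proof. by elim: l => //= x l ih; rewrite opw_eqNy ih inE eq_sym. Qed.

Lemma block_weight_eqy K l : (block_weight K l == +oo) = all (pred1 +oo) l.
Proof. by elim: l => //= x l ih; rewrite opw_eqy ih. Qed.

Lemma block_weight_mem K l : block_weight K l != +oo -> block_weight K l \in l.
Proof.
elim: l => //= x l ih h; case: (opw_either K x (block_weight K l)) => e.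
  by rewrite e mem_head.
by rewrite in_cons e ih ?orbT // -e.
Qed.

Lemma block_weight_best K l x : block_weight K l != -oo -> x \in l -> x != +oo ->
  ~~ better K x (block_weight K l).
Proof.
elim: l => //= y l ih; rewrite opw_eqNy negb_or => /andP[hy hl].
have bb u : better K u u = false by rewrite /better; case: K ih hl => *; exact: ltxx.
rewrite in_cons => /orP[/eqP ->|xl] hx.
  rewrite /opw (negPf hy) (negPf hl) /= (negPf hx).
  by case: eqP => _; rewrite ?bb //; case: ifP => h; rewrite ?bb ?h.
have h := ih hl xl hx.
have hl' : block_weight K l != +oo.
  by rewrite block_weight_eqy; apply/allPn; exists x.
rewrite /opw (negPf hy) (negPf hl) (negPf hl') /=; case: eqP => // _.
case: ifP => // h2; apply: contra h => h3; exact: better_trans h3 h2.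
Qed.

End Weights.

Section OmegaVal.
Local Open Scope classical_set_scope.
Local Open Scope ereal_scope.

Lemma ereal_sup_max (S : set (\bar RR)) c : S c -> (forall x, S x -> x <= c) ->
  ereal_sup S = c.
Proof.
move=> Sc hc; apply/le_anti/andP; split; last exact: ereal_sup_ubound.
exact: ge_ereal_sup.
Qed.

Lemma ereal_inf_min (S : set (\bar RR)) c : S c -> (forall x, S x -> c <= x) ->
  ereal_inf S = c.
Proof.
move=> Sc hc; apply/le_anti/andP; split; first exact: ereal_inf_lbound.
exact: le_ereal_inf_tmp.
Qed.

End OmegaVal.

Definition slice T (d : nat -> T) i n : seq T := [seq d m | m <- iota i n].

Lemma sliceP (T : eqType) (d : nat -> T) i n x :
  reflect (exists2 m, i <= m < i + n & x = d m) (x \in slice d i n).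
Proof.
by apply: (iffP mapP) => -[m]; rewrite ?mem_iota => hm ->; exists m; rewrite ?mem_iota.
Qed.

Lemma slice_cat T (d : nat -> T) i m n :
  slice d i (m + n) = slice d i m ++ slice d (i + m) n.
Proof. by rewrite /slice iotaD map_cat. Qed.

Lemma size_slice T (d : nat -> T) i n : size (slice d i n) = n.
Proof. by rewrite size_map size_iota. Qed.

Definition increasing (k : nat -> nat) : Prop := forall i, k i < k i.+1.

Lemma increasing_leq k i j : increasing k -> i <= j -> k i <= k j.
Proof.
move=> hk /subnK <-; elim: (j - i) => // n ih; rewrite addSn.
exact: leq_trans ih (ltnW (hk _)).
Qed.

Lemma increasing_ltn k i j : increasing k -> i < j -> k i < k j.
Proof. by move=> hk /(increasing_leq hk); apply: leq_trans. Qed.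

Lemma increasing_ge k i : increasing k -> i <= k i.
Proof. by move=> hk; elim: i => // i ih; exact: leq_ltn_trans ih (hk i). Qed.

Lemma increasing_block k m : increasing k -> k 0 <= m -> exists i, k i <= m < k i.+1.
Proof.
move=> hk h0; have [i] : exists i, m < k i by exists m.+1; exact: increasing_ge.
elim: i => [|i ih] hi; first lia.
by case: (ltnP m (k i)) => [/ih //|h]; exists i; rewrite h.
Qed.

Section OmegaBlocks.
Variables (K : Ksel) (d : nat -> \bar RR) (k : nat -> nat) (x y : \bar RR).
Hypothesis hk : increasing k.
Hypothesis hx : block_weight K (slice d 0 (k 0)) = x.
Hypothesis hy : forall i, block_weight K (slice d (k i) (k i.+1 - k i)) = y.
Local Open Scope ereal_scope.

Let prefixP z : (z \in slice d 0 (k 0)) <-> exists2 m, (m < k 0)%N & z = d m.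
Proof. by split=> [/sliceP|] [m hm ->]; [exists m => //; lia|apply/sliceP; exists m => //; lia]. Qed.

Let blockP i z : (z \in slice d (k i) (k i.+1 - k i)) <->
  exists2 m, (k i <= m < k i.+1)%N & z = d m.
Proof.
have := hk i => h; split=> [/sliceP|] [m hm ->]; first by exists m => //; lia.
by apply/sliceP; exists m => //; lia.
Qed.

Let d_cases m : d m \in slice d 0 (k 0) \/
  exists2 i, (k i <= m)%N & d m \in slice d (k i) (k i.+1 - k i).
Proof.
case: (ltnP m (k 0)) => h; first by left; apply/prefixP; exists m.
have [i hi] := increasing_block hk h.
by right; exists i; last (apply/blockP; exists m => //); lia.
Qed.

Lemma d_eqNy m : d m = -oo -> (x == -oo) || (y == -oo).
Proof.
move=> h; move: (d_cases m); rewrite h => -[|[i _]]; rewrite -(block_weight_eqNy K).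
  by rewrite hx => ->.
by rewrite hy orbC => ->.
Qed.

Hypothesis hNy : forall m, d m <> -oo.

Let xNy : x != -oo.
Proof.
by rewrite -hx block_weight_eqNy; apply/negP => /prefixP[m _ e]; exact: (hNy (esym e)).
Qed.

Let yNy : y != -oo.
Proof.
by rewrite -(hy 0) block_weight_eqNy; apply/negP => /blockP[m _ e]; exact: (hNy (esym e)).
Qed.

Let x_best m : (m < k 0)%N -> d m <> +oo -> ~~ better K (d m) x.
Proof.
move=> hm /eqP h; rewrite -hx; apply: block_weight_best => //; first by rewrite hx.
by apply/prefixP; exists m.
Qed.

Let y_best m : (k 0 <= m)%N -> d m <> +oo -> ~~ better K (d m) y.
Proof.
move=> hm /eqP h; have [i hi] := increasing_block hk hm; rewrite -(hy i).
apply: block_weight_best => //; first by rewrite hy.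
by apply/blockP; exists m.
Qed.

Let x_mem : x != +oo -> exists2 m, (m < k 0)%N & d m = x.
Proof.
by rewrite -hx => /block_weight_mem /prefixP[m]; exists m.
Qed.

Let y_mem i : y != +oo -> exists2 m, (k i <= m)%N & d m = y.
Proof.
by rewrite -(hy i) => /block_weight_mem /blockP[m hm ->]; exists m => //; case/andP: hm.
Qed.

Let xy_eqy m : d m <> +oo -> (x != +oo) || (y != +oo).
Proof.
move=> /eqP h; rewrite -hx -(hy 0); case: (d_cases m) => [hm|[i _ hm]].
  by rewrite block_weight_eqy; apply/orP; left; apply/allPn; exists (d m).
apply/orP; right; rewrite hy -(hy i) block_weight_eqy; apply/allPn; by exists (d m).
Qed.

Let y_eqy m : y = +oo -> d m <> +oo -> (m < k 0)%N.
Proof.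
move=> e /eqP h; rewrite ltnNge; apply/negP => hm.
have [i hi] := increasing_block hk hm; move/eqP: e; rewrite -(hy i) block_weight_eqy.
by apply/negP; apply/allPn; exists (d m) => //; apply/blockP; exists m.
Qed.

Let xy_best m : d m <> +oo -> ~~ better K (d m) (opw K x y).
Proof.
move=> /eqP h.
have best l : block_weight K l = opw K x y -> d m \in l -> ~~ better K (d m) (opw K x y).
  by move=> e hm; rewrite -e; apply: block_weight_best; rewrite ?e ?opw_eqNy ?negb_or ?xNy.
have [hm|[i _ hm]] := d_cases m.
  apply: (best (slice d 0 (k 0) ++ slice d (k 0) (k 1 - k 0))).
    by rewrite block_weight_cat hx hy.
  by rewrite mem_cat hm.
apply: (best (slice d 0 (k 0) ++ slice d (k i) (k i.+1 - k i))).
  by rewrite block_weight_cat hx hy.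
by rewrite mem_cat hm orbT.
Qed.

Let xy_mem : y != +oo -> exists2 m, d m <> +oo & d m = opw K x y.
Proof.
move=> hy'; have [m _ em] := y_mem 0 hy'.
have em' : exists2 m, d m <> +oo & d m = y by exists m => //; rewrite em; exact/eqP.
have [->|hx'] := eqVneq x +oo; first by rewrite opwyx.
have [m' _ em2] := x_mem hx'.
by case: (opw_either K x y) => -> //; exists m' => //; rewrite em2; exact/eqP.
Qed.

Lemma omega_val_blocks_Nyfree : omega_val K d = lasso_val K x y.
Proof.
have hno : ~ (exists i, d i = -oo) by move=> [i /hNy].
have [hall|hall] := pselect (forall m, d m = +oo).
  have -> : x = +oo.
    by apply/eqP; rewrite -hx block_weight_eqy; apply/allP => z /prefixP[m _ ->]; exact/eqP.
  have -> : y = +oo.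
    by apply/eqP; rewrite -(hy 0) block_weight_eqy; apply/allP => z /blockP[m _ ->]; exact/eqP.
  by case: K; rewrite /= /val_liminf /val_limsup /val_supninf;
    case: pselect => // hex; case: pselect.
have [m0 hm0] : exists m, d m <> +oo.
  by apply: contrapT => h; apply: hall => m; apply: contrapT => h'; apply: h; exists m.
have -> : lasso_val K x y = if K is K3 then opw K x y else if y == +oo then x else y.
  by rewrite /lasso_val (negPf xNy) (negPf yNy).
have [ey|ny] := eqVneq y +oo.
  have hfin : ~ (forall i, exists m, (i <= m)%N /\ d m <> +oo).
    by move=> /(_ (k 0))[m [hm /(y_eqy ey)]]; rewrite ltnNge hm.
  have nx : x != +oo by have := xy_eqy hm0; rewrite ey eqxx orbF.
  have [m hm em] := x_mem nx.
  have hm' : d m <> +oo by rewrite em; exact/eqP.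
  have best m' : d m' <> +oo -> ~~ better K (d m') x.
    by move=> h; apply: x_best => //; exact: y_eqy.
  rewrite ey opwxy; case: K best => /= best; rewrite /val_liminf /val_limsup /val_supninf;
    (case: pselect => // h1; case: pselect => // h2); try (case: pselect => // h3).
  - apply: ereal_inf_min => [|_ [m' /= h <-]]; first by exists m.
    by rewrite leNgt best.
  - apply: ereal_sup_max => [|_ [m' /= h <-]]; first by exists m.
    by rewrite leNgt best.
  - apply: ereal_sup_max => [|_ [m' /= h <-]]; first by exists m.
    by rewrite leNgt best.
have hmem i : exists m, [/\ (i <= m)%N, d m <> +oo & d m = y].
  have [m hm em] := y_mem i ny; exists m; split=> //; last by rewrite em; exact/eqP.
  exact: leq_trans (increasing_ge i hk) hm.
have hinf i : exists m, (i <= m)%N /\ d m <> +oo.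
  by have [m [hm hm' _]] := hmem i; exists m.
have ybest := y_best; have xybest := xy_best; have xymem := xy_mem ny.
have [m1 hm1 em1] := y_mem 0 ny.
have hm1' : d m1 <> +oo by rewrite em1; exact/eqP.
case: K ybest xybest xymem => /= ybest xybest xymem;
  rewrite /val_liminf /val_limsup /val_supninf;
  (case: pselect => // h1; case: pselect => // h2); try (case: pselect => // h3).
- apply: ereal_sup_max => [|_ [i _ <-]].
    exists (k 0) => //; apply: ereal_inf_min => [|_ [m /= [hm h] <-]]; first by exists m1.
    by rewrite leNgt ybest.
  by have [m [hm hm' em]] := hmem i; apply: ereal_inf_lbound; exists m.
- apply: ereal_inf_min => [|_ [i _ <-]].
    exists (k 0) => //; apply: ereal_sup_max => [|_ [m /= [hm h] <-]]; first by exists m1.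
    by rewrite leNgt ybest.
  by have [m [hm hm' em]] := hmem i; apply: ereal_sup_ubound; exists m.
- have [m hm em] := xymem.
  apply: ereal_sup_max => [|_ [m' /= h <-]]; first by exists m.
  by rewrite leNgt xybest.
Qed.

End OmegaBlocks.

Lemma omega_val_blocks K (d : nat -> \bar RR) k x y : increasing k ->
  block_weight K (slice d 0 (k 0)) = x ->
  (forall i, block_weight K (slice d (k i) (k i.+1 - k i)) = y) ->
  omega_val K d = lasso_val K x y.
Proof.
move=> hk hx hy; have [[m hm]|hno] := pselect (exists m, d m = -oo%E).
  rewrite /lasso_val (d_eqNy hk hx hy hm).
  case: K hx hy => hx hy; rewrite /= /val_liminf /val_limsup /val_supninf;
    by case: pselect => // -[]; exists m.
by apply: omega_val_blocks_Nyfree hk hx hy _ => m hm; apply: hno; exists m.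
Qed.

Lemma qbar_to_R_mono (x y : qbar) : (qbar_to_R x < qbar_to_R y)%E = (x < y)%E.
Proof. by case: x y => [r| |] [s| |] //=; rewrite ?lte_fin ?ltr_rat ?ltry ?ltNyr. Qed.

Lemma qbar_to_R_eqNy (x : qbar) : (qbar_to_R x == -oo%E) = (x == -oo%E).
Proof. by case: x. Qed.

Lemma qbar_to_R_eqy (x : qbar) : (qbar_to_R x == +oo%E) = (x == +oo%E).
Proof. by case: x. Qed.

Lemma qbar_to_R_opw K (x y : qbar) :
  qbar_to_R (opw K x y) = opw K (qbar_to_R x) (qbar_to_R y).
Proof.
rewrite /opw !qbar_to_R_eqNy !qbar_to_R_eqy.
have -> : better K (qbar_to_R x) (qbar_to_R y) = better K x y.
  by case: K; rewrite /better qbar_to_R_mono.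
by do !case: ifP => // _.
Qed.

Lemma qbar_to_R_lasso_val K (x y : qbar) :
  qbar_to_R (lasso_val K x y) = lasso_val K (qbar_to_R x) (qbar_to_R y).
Proof.
rewrite /lasso_val !qbar_to_R_eqNy !qbar_to_R_eqy -qbar_to_R_opw.
by case: ifP => // _; case: K => //; case: ifP.
Qed.

Lemma qbar_to_R_block_weight K (l : seq qbar) :
  qbar_to_R (block_weight K l) = block_weight K [seq qbar_to_R x | x <- l].
Proof. by elim: l => //= x l <-; rewrite qbar_to_R_opw. Qed.

(** * Ramsey's theorem for pairs *)

Definition infinite (P : nat -> Prop) : Prop := forall n, exists2 m, n <= m & P m.

Lemma infinite_color (T : finType) (P : nat -> Prop) (c : nat -> T) :
  infinite P -> exists t, infinite (fun m => P m /\ c m = t).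
Proof.
move=> hP; apply: contrapT => hn.
have bound t : exists n, forall m, n <= m -> P m -> c m <> t.
  apply: contrapT => h; apply: hn; exists t => n; apply: contrapT => h2; apply: h.
  by exists n => m hm Pm e; apply: h2; exists m.
have [b hb] := choice bound.
have [m hm Pm] := hP (\max_t b t).
by apply: (hb (c m) m) => //; apply: leq_trans hm; exact: leq_bigmax.
Qed.

Lemma increasing_iter (P : nat -> nat -> Prop) :
  (forall m, exists2 n, m < n & P m n) ->
  exists2 k, increasing k & forall i, P (k i) (k i.+1).
Proof.
move=> h; have /choice[f hf] : forall m, exists n, m < n /\ P m n.
  by move=> m; have [n] := h m; exists n.
by exists (fun i => iter i f 0) => i; have [] := hf (iter i f 0).
Qed.

Lemma ramsey (T : finType) (c : nat -> nat -> T) :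
  exists t k, increasing k /\ forall i j, i < j -> c (k i) (k j) = t.
Proof.
(* Each step picks an element a of the current infinite set P and shrinks P to
   the elements above a whose pair with a has one fixed colour. *)
have step (P : {P : nat -> Prop | infinite P}) :
    exists r : nat * T * {P : nat -> Prop | infinite P},
    sval P r.1.1 /\ forall m, sval r.2 m ->
      [/\ sval P m, r.1.1 < m & c r.1.1 m = r.1.2].
  case: P => P hP /=; have [a _ Pa] := hP 0.
  have hP' : infinite (fun m => P m /\ a < m).
    by move=> n; have [m hm Pm] := hP (maxn n a.+1); exists m; [lia|split=> //; lia].
  have [t ht] := infinite_color (c a) hP'.
  by exists (a, t, exist _ _ ht); split=> //= m [[? ?] ?].
have [f hf] := choice step.
pose S i := iter i (fun P => (f P).2) (exist infinite xpredT (fun n => ex_intro2 _ _ n (leqnn n) isT)).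
pose a i := (f (S i)).1.1; pose col i := (f (S i)).1.2.
have sub i j m : i <= j -> sval (S j) m -> sval (S i) m.
  move=> /subnK <-; elim: (j - i) m => // n ih m; rewrite addSn.
  by move=> /(hf (S (n + i))).2 [/ih].
have ha i j : i < j -> a i < a j /\ c (a i) (a j) = col i.
  by move=> /sub /(_ (hf (S j)).1) /(hf (S i)).2[].
have [t ht] : exists t, infinite (fun i => True /\ col i = t).
  by apply: infinite_color => n; exists n.
have /increasing_iter[l hl hlt] : forall m, exists2 n, m < n & col n = t.
  by move=> m; have [n hn [_ hc]] := ht m.+1; exists n.
exists t, (fun i => a (l i.+1)); split=> [i|i j hij]; first by have [] := ha _ _ (hl i.+1).
by have [_ ->] := ha _ _ (increasing_ltn hl (hij : i.+1 < j.+1)).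
Qed.

(** * Arrows: the finite information carried by a word *)

Notation arrow := (nat * qbar * bool * nat)%type.

Section Arrows.
Variables (A : finType) (K : Ksel) (N : wba A).
Implicit Types (u v : seq A) (w : nat -> A) (r : nat -> 'I_(nstates N)).

(* (p, x, b, q) is an arrow of u when some path from p to q over u has weight x;
   b tells whether that path enters a final state after its first state. *)
Definition extend_arrow (a : A) (p : nat) (e : arrow) : arrow :=
  (p, opw K (weight N p a e.1.1.1) e.1.1.2, is_fin N e.1.1.1 || e.1.2, e.2).

Definition arrows u : seq arrow :=
  foldr (fun a s => flatten [seq [seq extend_arrow a p e | e <- s] | p <- iota 0 (nstates N)])
    [seq (q, +oo%E, false, q) | q <- iota 0 (nstates N)] u.

Lemma mem_arrows_nil p x b q : (p, x, b, q) \in arrows [::] <->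
  [/\ p = q, x = +oo%E, b = false & p < nstates N].
Proof.
split=> [/mapP[p']|[-> -> -> h]]; last by apply/mapP; exists q; rewrite ?mem_iota.
by rewrite mem_iota => h [-> -> -> ->].
Qed.

Lemma mem_arrows_cons a u p x b q : (p, x, b, q) \in arrows (a :: u) <->
  exists p' x' b', [/\ (p', x', b', q) \in arrows u, p < nstates N,
    x = opw K (weight N p a p') x' & b = is_fin N p' || b'].
Proof.
split=> [/flatten_mapP[p1]|[p'] [x'] [b'] [h hp -> ->]].
  rewrite mem_iota => hp /mapP[[[[p' x'] b'] q']] h [-> -> -> ->].
  by exists p', x', b'.
apply/flatten_mapP; exists p; first by rewrite mem_iota.
by apply/mapP; exists (p', x', b', q).
Qed.

Lemma arrows_bound u p x b q : (p, x, b, q) \in arrows u ->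
  p < nstates N /\ q < nstates N.
Proof.
elim: u p x b => [|a u ih] p x b; first by move=> /mem_arrows_nil[<- _ _ h].
by move=> /mem_arrows_cons[p'] [x'] [b'] [/ih[_ hq] hp _ _].
Qed.

Lemma mem_arrows_cat u v p x b q : (p, x, b, q) \in arrows (u ++ v) <->
  exists p' x1 b1 x2 b2, [/\ (p, x1, b1, p') \in arrows u,
    (p', x2, b2, q) \in arrows v, x = opw K x1 x2 & b = b1 || b2].
Proof.
elim: u p x b => [|a u ih] p x b /=.
  split=> [h|[p'] [x1] [b1] [x2] [b2] [/mem_arrows_nil[-> -> -> _] h -> ->]].
    have [hp hq] := arrows_bound h; exists p, +oo%E, false, x, b; split=> //.
      exact/mem_arrows_nil.
    by rewrite opwyx.
  by rewrite opwyx.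
split=> [/mem_arrows_cons[p1] [x1] [b1] [/ih[p'] [x2] [b2] [x3] [b3] [h1 h2 -> ->] hp -> ->]|].
  exists p', (opw K (weight N p a p1) x2), (is_fin N p1 || b2), x3, b3.
  by split; rewrite ?opwA ?orbA //; apply/mem_arrows_cons; exists p1, x2, b2.
move=> [p'] [x1] [b1] [x2] [b2] [/mem_arrows_cons[p1] [x3] [b3] [h hp -> ->] h2 -> ->].
apply/mem_arrows_cons; exists p1, (opw K x3 x2), (b3 || b2).
by split; rewrite ?opwA ?orbA //; apply/ih; exists p', x3, b3, x2, b2.
Qed.

Lemma arrows_cat_congr u u' v v' : arrows u =i arrows u' -> arrows v =i arrows v' ->
  arrows (u ++ v) =i arrows (u' ++ v').
Proof.
move=> hu hv [[[p x] b] q]; apply/idP/idP => /mem_arrows_cat[p'] [x1] [b1] [x2] [b2] [];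
  [rewrite hu hv|rewrite -hu -hv] => h1 h2 ex eb;
  by apply/mem_arrows_cat; exists p', x1, b1, x2, b2.
Qed.

Definition run_weight w r i n : qbar :=
  block_weight K [seq weight N (r m) (w m) (r m.+1) | m <- iota i n].

Definition run_fin r i n : bool := has (fun m => is_fin N (r m.+1)) (iota i n).

Lemma arrows_run w r i n :
  (r i : nat, run_weight w r i n, run_fin r i n, r (i + n) : nat) \in arrows (slice w i n).
Proof.
elim: n i => [|n ih] i.
  by apply/mem_arrows_nil; rewrite addn0; split.
apply/mem_arrows_cons; exists (nat_of_ord (r i.+1)), (run_weight w r i.+1 n), (run_fin r i.+1 n).
by rewrite -addSnnS; split.
Qed.

Lemma eq_run_weight w r r' i n : (forall m, i <= m <= i + n -> r m = r' m) ->
  run_weight w r i n = run_weight w r' i n.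
Proof.
move=> h; congr block_weight; apply/eq_in_map => m; rewrite mem_iota => hm.
by rewrite !h //; lia.
Qed.

Lemma eq_run_fin r r' i n : (forall m, i <= m <= i + n -> r m = r' m) ->
  run_fin r i n = run_fin r' i n.
Proof.
by move=> h; apply/eq_in_has => m; rewrite mem_iota => hm; rewrite h //; lia.
Qed.

Lemma run_of_arrow w i n p x b q : (p, x, b, q) \in arrows (slice w i n) ->
  exists r, [/\ r i = p :> nat, r (i + n) = q :> nat,
    run_weight w r i n = x & run_fin r i n = b].
Proof.
elim: n i p x b => [|n ih] i p x b.
  by move=> /mem_arrows_nil[-> -> -> hq]; exists (fun=> Ordinal hq).
move=> /mem_arrows_cons[p'] [x'] [b'] [/ih[r [h1 h2 h3 h4]] hp -> ->].
pose r' m := if m <= i then Ordinal hp else r m; exists r'.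
have e m : i.+1 <= m <= i.+1 + n -> r' m = r m by rewrite /r' => hm; rewrite ifN //; lia.
have ei : r' i = p :> nat by rewrite /r' leqnn.
have ei1 : r' i.+1 = p' :> nat by rewrite e ?h1 //; lia.
split=> //; first by rewrite -addSnnS e ?h2 //; lia.
- rewrite /run_weight /= ei ei1; congr opw.
  by rewrite -[LHS]/(run_weight w r' i.+1 n) (eq_run_weight w e).
- rewrite /run_fin /= ei1; congr orb.
  by rewrite -[LHS]/(run_fin r' i.+1 n) (eq_run_fin e).
Qed.
Lemma glue_runs w k (s : nat -> nat) (x : nat -> qbar) (b : nat -> bool) :
  increasing k -> k 0 = 0 ->
  (forall i, (s i, x i, b i, s i.+1) \in arrows (slice w (k i) (k i.+1 - k i))) ->
  exists r, forall i, [/\ r (k i) = s i :> nat,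
    run_weight w r (k i) (k i.+1 - k i) = x i & run_fin r (k i) (k i.+1 - k i) = b i].
Proof.
move=> hk k0 hs; have /choice[f hf] := fun i => run_of_arrow (hs i).
pose idx m := iter m (fun p => if k p.1.+1 == p.2.+1 then (p.1.+1, p.2.+1) else (p.1, p.2.+1)) (0, 0).
have idx2 m : (idx m).2 = m by elim: m => //= m ih; case: ifP; rewrite /= ih.
have idx1 m : k (idx m).1 <= m < k (idx m).1.+1.
  elim: m => [|m ih]; first by have := hk 0; rewrite /= k0.
  rewrite /= -/(idx m) idx2; case: eqP => [<-|] /=; first by rewrite leqnn hk.
  by lia.
have idxE i m : k i <= m < k i.+1 -> (idx m).1 = i.
  move=> hm; have := idx1 m; case: (ltngtP (idx m).1 i) => // h.
    by have := increasing_leq hk h; lia.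
  by have := increasing_leq hk h; lia.
pose r m := f (idx m).1 m; exists r => i.
have e m : k i <= m <= k i + (k i.+1 - k i) -> r m = f i m.
  move=> hm; have hi := hk i; case: (ltnP m (k i.+1)) => h; first by rewrite /r (idxE i) //; lia.
  have -> : m = k i.+1 by lia.
  rewrite /r (idxE i.+1) ?leqnn ?hk //; apply: ord_inj.
  have [-> _ _ _] := hf i.+1; have [_ <- _ _] := hf i; by congr (nat_of_ord (f i _)); lia.
have [h1 _ <- <-] := hf i; split; first by rewrite e ?h1 //; lia.
  exact: eq_run_weight.
exact: eq_run_fin.
Qed.

Lemma path_weight_blocks w r k x y : increasing k ->
  run_weight w r 0 (k 0) = x ->
  (forall i, run_weight w r (k i) (k i.+1 - k i) = y) ->
  path_weight K N w r = qbar_to_R (lasso_val K x y).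
Proof.
move=> hk hx hy; rewrite qbar_to_R_lasso_val.
have e i n : block_weight K (slice (fun j => qbar_to_R (wt N (r j, w j, r j.+1))) i n) =
    qbar_to_R (run_weight w r i n).
  rewrite qbar_to_R_block_weight -map_comp; congr block_weight.
  by apply: eq_map => j /=; rewrite weightE.
by apply: (omega_val_blocks hk); [rewrite e hx|move=> i; rewrite e hy].
Qed.

Lemma lasso_run w k p x b q y : increasing k -> 0 < k 0 -> is_init N p ->
  (p, x, b, q) \in arrows (slice w 0 (k 0)) ->
  (forall i, (q, y, true, q) \in arrows (slice w (k i) (k i.+1 - k i))) ->
  exists2 r, successful N r & path_weight K N w r = qbar_to_R (lasso_val K x y).
Proof.
move=> hk k0 ip hx hy.
pose k' i := if i is i'.+1 then k i' else 0.
have hk' : increasing k' by case.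
have [|r hr] := glue_runs (w := w) (s := fun i => if i is _.+1 then q else p)
    (x := fun i => if i is _.+1 then y else x) (b := fun i => if i is _.+1 then true else b)
    hk' erefl.
- by case=> [|i] //=; rewrite subn0.
exists r; last first.
  apply: path_weight_blocks hk _ _ => [|i]; last by have [] := hr i.+1.
  by have [_ + _] := hr 0; rewrite /= subn0.
split; first by rewrite -is_initE; have [-> _ _] := hr 0.
have hinf : infinite (fun m => r m \in fin N).
  move=> n; have [_ _ /= /hasP[m]] := hr n.+1.
  rewrite mem_iota is_finE => hm hf; exists m.+1 => //.
  by have := increasing_ge n hk; lia.
have [f hf] := infinite_color r hinf; exists f.
  by have [m _ [h <-]] := hf 0.
by move=> i; have [m hm [_ e]] := hf i; exists m.
Qed.

Lemma homogeneous_run w r k p y b q : successful N r -> increasing k ->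
  (forall i j, i < j -> (r (k i) : nat, run_weight w r (k i) (k j - k i),
     run_fin r (k i) (k j - k i), r (k j) : nat) = (p, y, b, q)) ->
  [/\ p = q, b = true, r (k 0) = q :> nat &
    path_weight K N w r = qbar_to_R (lasso_val K (run_weight w r 0 (k 0)) y)].
Proof.
move=> [_ [f ff hf]] hk h.
have epq : p = q by have [_ _ _ <-] := h 0 1 isT; have [-> _ _ _] := h 1 2 isT.
split=> //.
- have [m [hm em]] := hf (k 0).+1.
  have [_ _ <- _] := h 0 m.+1 isT; apply/hasP; exists m.-1.
    by have := increasing_ge m.+1 hk; rewrite mem_iota; lia.
  by rewrite prednK ?em ?is_finE //; lia.
- by have [-> _ _ _] := h 0 1 isT.
- by apply: (path_weight_blocks hk) => // i; have [_ -> _ _] := h i i.+1 (ltnSn i).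
Qed.

End Arrows.

(** * Certificates of non-inclusion *)

Section Profile.
Variables (A : finType) (K : Ksel) (N : wba A).
Implicit Types (u v : seq A) (w : nat -> A).

Definition weights : seq qbar :=
  +oo%E :: [seq weight N e.1 e.2 q |
    e <- [seq (p, a) | p <- iota 0 (nstates N), a <- enum A], q <- iota 0 (nstates N)].

Definition all_arrows : seq arrow :=
  [seq (e, q) | e <- [seq (e, b) | e <- [seq (p, x) | p <- iota 0 (nstates N), x <- weights],
                                   b <- [:: true; false]], q <- iota 0 (nstates N)].

Lemma weights_sub u p x b q : (p, x, b, q) \in arrows K N u -> x \in weights.
Proof.
elim: u p x b => [|a u ih] p x b; first by move=> /mem_arrows_nil[_ -> _ _].
move=> /mem_arrows_cons[p'] [x'] [b'] [h hp -> _].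
case: (opw_either K (weight N p a p') x') => ->; last exact: ih h.
have [hp' _] := arrows_bound h.
rewrite in_cons; apply/orP; right; apply/allpairsP; exists ((p, a), p') => /=.
split=> //; last by rewrite mem_iota.
by apply/allpairsP; exists (p, a); rewrite mem_iota mem_enum.
Qed.

Lemma all_arrows_sub u : {subset arrows K N u <= all_arrows}.
Proof.
move=> [[[p x] b] q] h; have [hp hq] := arrows_bound h; have hx := weights_sub h.
apply/allpairsP; exists ((p, x, b), q); rewrite mem_iota; split=> //.
apply/allpairsP; exists ((p, x), b); split=> //; last by case: b {h}.
by apply/allpairsP; exists (p, x); rewrite mem_iota.
Qed.

Definition profile u : {ffun 'I_(size all_arrows) -> bool} :=
  [ffun i : 'I__ => nth (0, +oo%E, false, 0) all_arrows i \in arrows K N u].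

Lemma profile_eq u v : profile u = profile v <-> arrows K N u =i arrows K N v.
Proof.
split=> [h e|h]; last by apply/ffunP => i; rewrite !ffunE h.
have [/(nthP (0, +oo%E, false, 0))[i hi <-]|he] := boolP (e \in all_arrows).
  by have := congr1 (fun f : {ffun _ -> _} => f (Ordinal hi)) h; rewrite !ffunE.
by apply/idP/idP => /all_arrows_sub; rewrite (negPf he).
Qed.

Definition lassos u v : seq qbar :=
  flatten [seq flatten [seq
    if [&& is_init N e.1.1.1, e.2 == l.1.1.1, l.1.1.1 == l.2 & l.1.2]
    then [:: lasso_val K e.1.1.2 l.1.1.2] else [::] | l <- arrows K N v] | e <- arrows K N u].

Lemma lassosP u v c : (c \in lassos u v) <-> exists p x b q y,
  [/\ is_init N p, (p, x, b, q) \in arrows K N u, (q, y, true, q) \in arrows K N v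
    & c = lasso_val K x y].
Proof.
split=> [/flatten_mapP[[[[p x] b] q] hu] /flatten_mapP[[[[q1 y] b'] q'] hv] /=|].
  case: and4P => // -[hp /eqP e /eqP e' eb]; rewrite inE => /eqP ->.
  by move: hv; rewrite eb -e' -e => hv; exists p, x, b, q, y.
move=> [p] [x] [b] [q] [y] [hp hu hv ->].
apply/flatten_mapP; exists (p, x, b, q) => //; apply/flatten_mapP; exists (q, y, true, q) => //=.
by rewrite hp !eqxx inE.
Qed.

Definition same_arrows u v : bool :=
  all (fun e => e \in arrows K N v) (arrows K N u) &&
  all (fun e => e \in arrows K N u) (arrows K N v).

Lemma same_arrowsP u v : reflect (arrows K N u =i arrows K N v) (same_arrows u v).
Proof.
apply: (iffP andP) => [[/allP h1 /allP h2] e|h].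
  by apply/idP/idP => [/h1|/h2].
by split; apply/allP => e; rewrite h.
Qed.

Lemma lasso_le_behavior w k u v c : increasing k -> 0 < k 0 ->
  arrows K N (slice w 0 (k 0)) =i arrows K N u ->
  (forall i, arrows K N (slice w (k i) (k i.+1 - k i)) =i arrows K N v) ->
  c \in lassos u v -> (qbar_to_R c <= behavior K N w)%E.
Proof.
move=> hk k0 hu hv /lassosP[p] [x] [b] [q] [y] [hp h1 h2 ->].
rewrite -hu in h1; have h2' i : (q, y, true, q) \in arrows K N (slice w (k i) (k i.+1 - k i)).
  by rewrite hv.
have [r hr <-] := lasso_run hk k0 hp h1 h2'.
by apply: ereal_sup_ubound; exists r.
Qed.

Lemma homogeneous_positions w r (k : nat -> nat) : increasing k -> successful N r ->
  exists l y, [/\ increasing l,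
    (forall i j, i < j -> exists q,
       (r (k (l i)) : nat, run_weight K w r (k (l i)) (k (l j) - k (l i)),
        run_fin r (k (l i)) (k (l j) - k (l i)), r (k (l j)) : nat) = (q, y, true, q)) &
    forall l', increasing l' ->
      path_weight K N w r =
      qbar_to_R (lasso_val K (run_weight K w r 0 (k (l (l' 0)))) y)].
Proof.
move=> hk hr.
pose c i j : arrow := (r (k i) : nat, run_weight K w r (k i) (k j - k i),
  run_fin r (k i) (k j - k i), r (k j) : nat).
have hc i j : i < j -> c i j \in all_arrows.
  move=> hij; have := arrows_run K w r (k i) (k j - k i).
  rewrite subnKC; first exact: all_arrows_sub.
  by apply/ltnW/increasing_ltn.
have [t [l [hl hlt]]] := ramsey
  (fun i j => inord (index (c i j) all_arrows) : 'I_(size all_arrows).+1).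
have hct i j : i < j -> c (l i) (l j) = nth (0, +oo%E, false, 0) all_arrows t.
  move=> hij; have lij := increasing_ltn hl hij.
  rewrite -(hlt _ _ hij) inordK ?nth_index ?hc // ltnS; exact: index_size.
case et : (nth _ _ _) hct => [[[p y] b] q] hct.
exists l, y.
have hom l' : increasing l' -> increasing (fun i => k (l (l' i))) /\
    forall i j, i < j -> c (l (l' i)) (l (l' j)) = (p, y, b, q).
  move=> hl'; split=> [i|i j hij]; last by apply: hct; exact: increasing_ltn.
  by apply: increasing_ltn => //; exact: increasing_ltn.
split=> // [i j hij|l' hl'].
  have [//|h1 h2] := hom id; have [e1 e2 _ _] := homogeneous_run hr h1 h2.
  by exists q; rewrite -/(c _ _) hct // e1 e2.
by have [h1 h2] := hom l' hl'; have [_ _ _ ->] := homogeneous_run hr h1 h2.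
Qed.

End Profile.

Section Periodic.
Variables (A : finType) (a : A) (u v : seq A).

Definition periodic_word (m : nat) : A :=
  if m < size u then nth a u m else nth a v ((m - size u) %% size v).

Lemma slice_periodic_prefix : slice periodic_word 0 (size u) = u.
Proof.
apply: (@eq_from_nth _ a); rewrite size_slice // => i hi.
by rewrite (nth_map 0) ?size_iota // nth_iota // /periodic_word hi.
Qed.

Lemma slice_periodic_loop i :
  slice periodic_word (size u + i * size v) (size v) = v.
Proof.
apply: (@eq_from_nth _ a); rewrite size_slice // => j hj.
rewrite (nth_map 0) ?size_iota // nth_iota // /periodic_word ifN; last by lia.
by rewrite -addnA addKn modnMDl modn_small.
Qed.

Variables (K : Ksel) (N : wba A).
Hypothesis huv : arrows K N (u ++ v) =i arrows K N u.
Hypothesis hvv : arrows K N (v ++ v) =i arrows K N v.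

Lemma arrows_periodic_prefix n :
  arrows K N (slice periodic_word 0 (size u + n * size v)) =i arrows K N u.
Proof.
elim: n => [|n ih] e; first by rewrite addn0 slice_periodic_prefix.
rewrite mulSnr addnA slice_cat add0n slice_periodic_loop.
by rewrite (arrows_cat_congr ih (fun=> erefl)) huv.
Qed.

Lemma arrows_periodic_loop i n :
  arrows K N (slice periodic_word (size u + i * size v) (n.+1 * size v)) =i arrows K N v.
Proof.
elim: n => [|n ih] e; first by rewrite mul1n slice_periodic_loop.
rewrite mulSnr slice_cat -addnA -mulnDl slice_periodic_loop.
by rewrite (arrows_cat_congr ih (fun=> erefl)) hvv.
Qed.

End Periodic.

Lemma ereal_sup_lt (S : set (\bar RR)) (l : seq qbar) (c : qbar) : (-oo < c)%E ->
  (forall x, S x -> exists2 c', c' \in l & x = qbar_to_R c') ->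
  {in l, forall c', (c' < c)%E} -> (ereal_sup S < qbar_to_R c)%E.
Proof.
move=> hc hS hl.
have [m hm hml] : exists2 m : qbar, (m < c)%E & {in l, forall c', (c' <= m)%E}.
  elim: l {hS} hl => [|x l ih] hl; first by exists -oo%E.
  have [|m hm hml] := ih; first by move=> c' h; apply: hl; rewrite in_cons h orbT.
  exists (Order.max x m); first by rewrite gt_max hm hl // mem_head.
  move=> c'; rewrite in_cons le_max => /orP[/eqP ->|/hml ->]; first by rewrite lexx.
  by rewrite orbT.
apply: (@le_lt_trans _ _ (qbar_to_R m)); last by rewrite qbar_to_R_mono.
by apply: ge_ereal_sup => _ /hS[c' /hml h ->]; rewrite leNgt qbar_to_R_mono -leNgt.
Qed.

Section Certificate.
Variables (A : finType) (K : Ksel) (N N' : wba A).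

Definition certificate (u v : seq A) : bool :=
  [&& same_arrows K N' (u ++ v) u, same_arrows K N' (v ++ v) v &
    has (fun c => (-oo < c)%E && all (fun c' => c' < c)%E (lassos K N' u v)) (lassos K N u v)].

Lemma certificate_sound u v : u != [::] -> v != [::] -> certificate u v ->
  ~ qinclusion K N N'.
Proof.
case: u => // a u _; case: v => // b v _; set u1 := a :: u; set v1 := b :: v.
move=> /and3P[/same_arrowsP huv /same_arrowsP hvv /hasP[c hc /andP[c0 /allP hall]]].
pose w := periodic_word a u1 v1; pose k i := size u1 + i * size v1.
have sv : 0 < size v1 by [].
have hk : increasing k by move=> i; rewrite /k mulSn; lia.
have ek i n : k (i + n) - k i = n * size v1 by rewrite /k mulnDl; lia.
move=> /(_ w); apply/negP; rewrite -ltNge.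
apply: (@lt_le_trans _ _ (qbar_to_R c)); last first.
  apply: (lasso_le_behavior hk) hc => [//||i e].
    by rewrite /k mul0n addn0 slice_periodic_prefix.
  by rewrite -addn1 ek mul1n slice_periodic_loop.
apply: ereal_sup_lt c0 _ hall => _ [r hr <-].
have [l [y [hl hly hw]]] := homogeneous_positions K w hk hr.
rewrite (hw id) //; eexists; last reflexivity.
apply/lassosP; exists (r 0 : nat), (run_weight K w r 0 (k (l 0))),
  (run_fin r 0 (k (l 0))), (r (k (l 0)) : nat), y.
split=> //; first by rewrite is_initE; case: hr.
  by rewrite -(arrows_periodic_prefix a huv (l 0)); exact: (arrows_run K w r 0).
have [q e] := hly 0 1 isT.
have := arrows_run K w r (k (l 0)) (k (l 1) - k (l 0)).
have l01 : l 0 < l 1 by [].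
rewrite subnKC ?e; last by apply/ltnW/increasing_ltn.
case: e => -> _ _ _.
have -> : l 1 = l 0 + (l 1 - l 0).-1.+1 by lia.
by rewrite ek (arrows_periodic_loop a u1 hvv).
Qed.

Lemma certificate_complete : ~ qinclusion K N N' ->
  exists a u b v, certificate (a :: u) (b :: v).
Proof.
move=> hn; have [w hw] : exists w, (behavior K N' w < behavior K N w)%E.
  apply: contrapT => h; apply: hn => w; rewrite leNgt; apply/negP => h'.
  by apply: h; exists w.
have [_ [r hr <-] hlt] := ereal_sup_gt hw.
have [k1 [y [hk1 hy hwt]]] := homogeneous_positions K w (k := id) (fun=> ltnSn _) hr.
have [t [l [hl ht]]] := ramsey
  (fun i j => profile K N' (slice w (k1 i) (k1 j - k1 i))).
pose k i := k1 (l i.+1).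
have hk : increasing k by move=> i; exact: (increasing_ltn hk1 (hl _)).
have k0 : 0 < k 0.
  by have := increasing_ge (l 1) hk1; have := hl 0; rewrite /k; lia.
have hsame i j i' j' : i < j -> i' < j' ->
    arrows K N' (slice w (k i) (k j - k i)) =i arrows K N' (slice w (k i') (k j' - k i')).
  by move=> h1 h2; apply/profile_eq; rewrite !ht.
have hcat i j m : i <= j -> j <= m ->
    slice w (k i) (k m - k i) = slice w (k i) (k j - k i) ++ slice w (k j) (k m - k j).
  move=> /(increasing_leq hk) h1 /(increasing_leq hk) h2.
  by rewrite -[in slice w (k j)](subnKC h1) -slice_cat; congr slice; lia.
have hcat0 i j : i <= j -> slice w 0 (k j) = slice w 0 (k i) ++ slice w (k i) (k j - k i).
  by move=> /(increasing_leq hk) h1; rewrite -{2}[k i]add0n -slice_cat subnKC.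
pose u := slice w 0 (k 1); pose v := slice w (k 1) (k 2 - k 1).
suff hc : certificate u v.
  case eu : u => [|a u']; first by have := congr1 size eu; rewrite size_slice /=; have := hk 0; lia.
  case ev : v => [|b v']; first by have := congr1 size ev; rewrite size_slice /=; have := hk 1; lia.
  by exists a, u', b, v'; rewrite -eu -ev.
have hvv : arrows K N' (v ++ v) =i arrows K N' v.
  move=> e; rewrite -(arrows_cat_congr (hsame 0 1 1 2 isT isT) (fun=> erefl)).
  by rewrite -hcat // (hsame 0 2 1 2).
have hu0 : u = slice w 0 (k 0) ++ slice w (k 0) (k 1 - k 0) by exact: hcat0.
have hkS : increasing (fun i => k i.+1) by move=> i; exact: hk.
apply/and3P; split; [apply/same_arrowsP|exact/same_arrowsP|].
  rewrite hu0 -catA; apply: arrows_cat_congr => // e; rewrite (arrows_cat_congr (hsame 0 1 1 2 isT isT) (fun=> erefl)) hvv.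
  exact: hsame.
apply/hasP; exists (lasso_val K (run_weight K w r 0 (k 1)) y).
  apply/lassosP; exists (r 0 : nat), (run_weight K w r 0 (k 1)),
    (run_fin r 0 (k 1)), (r (k 1) : nat), y.
  split=> //; first by rewrite is_initE; case: hr.
    exact: arrows_run.
  have [q e] := hy (l 2) (l 3) (hl 2).
  have := arrows_run K w r (k 1) (k 2 - k 1).
  rewrite subnKC; last exact/ltnW/hk.
  by rewrite e; case: e => -> _ _ _.
have hwt' := hwt (fun i => l i.+2) (fun i => hl i.+2).
rewrite hwt' in hlt.
rewrite -qbar_to_R_mono (le_lt_trans (leNye _) hlt); apply/allP => c' hc'.
rewrite -qbar_to_R_mono; apply: le_lt_trans hlt.
apply: (lasso_le_behavior hkS _ _ _ hc') => [|e|i]; last exact: hsame.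
  exact: leq_ltn_trans (hk 0).
by [].
Qed.

End Certificate.

(** * Certificates of bounded size *)

Lemma shorten_word (A : Type) (T : finType) (f : seq A -> T) :
  (forall x y z, f x = f y -> f (x ++ z) = f (y ++ z)) ->
  forall u, exists2 u', size u' < #|T| & f u' = f u.
Proof.
move=> hf u; have [n hn] := ubnP (size u); elim: n u hn => // n ih u hu.
have [hT|hT] := ltnP (size u) #|T|; first by exists u.
pose g (i : 'I_(size u).+1) := f (take i u).
have /injectivePn[i [j hij e]] : ~~ injectiveb g.
  apply/negP => /injectiveP /leq_card; rewrite card_ord; lia.
wlog lij : i j hij e / i < j.
  move=> h; case: (ltngtP i j) => lij; [exact: h lij| |].
    by apply: (h j i) => //; rewrite eq_sym.
  by rewrite (ord_inj lij) eqxx in hij.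
have [|u' hu' eu] := ih (take i u ++ drop j u).
  rewrite size_cat size_take size_drop; have := ltn_ord j; case: ifP; lia.
by exists u' => //; rewrite eu (hf _ (take j u)) // cat_take_drop.
Qed.

Section Bound.
Variables (A : finType) (K : Ksel).

Lemma lassos_eq (N : wba A) u u' v v' : arrows K N u =i arrows K N u' ->
  arrows K N v =i arrows K N v' -> lassos K N u v =i lassos K N u' v'.
Proof.
move=> hu hv c; apply/idP/idP => /lassosP[p] [x] [b] [q] [y] [];
  [rewrite hu hv|rewrite -hu -hv] => hp h1 h2 ec; apply/lassosP;
  by exists p, x, b, q, y.
Qed.

Lemma certificate_congr (N N' : wba A) u u' v v' :
  arrows K N u =i arrows K N u' -> arrows K N' u =i arrows K N' u' ->
  arrows K N v =i arrows K N v' -> arrows K N' v =i arrows K N' v' ->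
  certificate K N N' u v -> certificate K N N' u' v'.
Proof.
move=> hu hu' hv hv' /and3P[/same_arrowsP h1 /same_arrowsP h2 h3]; apply/and3P; split.
- by apply/same_arrowsP => e; rewrite -hu' -h1; symmetry; exact: arrows_cat_congr.
- by apply/same_arrowsP => e; rewrite -hv' -h2; symmetry; exact: arrows_cat_congr.
- rewrite -(eq_has_r (lassos_eq hu hv)); apply: sub_has h3 => c.
  by rewrite (eq_all_r (lassos_eq hu' hv')).
Qed.

Definition arrow_count (N : wba A) : nat :=
  let n := nstates N in n * (n * #|A| * n).+1 * 2 * n.

Lemma size_all_arrows (N : wba A) : size (all_arrows N) = arrow_count N.
Proof. by rewrite !size_allpairs /= !size_allpairs !size_iota -cardE. Qed.

Definition word_bound (N N' : wba A) : nat := 2 ^ (arrow_count N + arrow_count N').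

Lemma certificate_bounded (N N' : wba A) a u b v :
  certificate K N N' (a :: u) (b :: v) -> exists u' v',
  [/\ size u' < word_bound N N', size v' < word_bound N N'
    & certificate K N N' (a :: u') (b :: v')].
Proof.
pose f w := (profile K N w, profile K N' w).
have hf x y z : f x = f y -> f (x ++ z) = f (y ++ z).
  by move=> [/profile_eq h1 /profile_eq h2]; congr (_, _); apply/profile_eq;
    exact: arrows_cat_congr.
have -> : word_bound N N' = #|{: {ffun 'I_(size (all_arrows N)) -> bool} *
                                {ffun 'I_(size (all_arrows N')) -> bool}}|.
  by rewrite card_prod !card_ffun !card_ord card_bool !size_all_arrows -expnD.
have [u' hu [/profile_eq hu1 /profile_eq hu2]] := shorten_word hf u.
have [v' hv [/profile_eq hv1 /profile_eq hv2]] := shorten_word hf v.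
move=> h; exists u', v'; split=> //.
have cons_congr (M : wba A) c w w' : arrows K M w' =i arrows K M w ->
    arrows K M (c :: w) =i arrows K M (c :: w').
  move=> e x; symmetry.
  exact: (arrows_cat_congr (u := [:: c]) (u' := [:: c]) (fun=> erefl) e).
by apply: certificate_congr h; apply: cons_congr.
Qed.

Definition words_upto (n : nat) : seq (seq A) :=
  iter n (fun l => [::] :: flatten [seq [seq a :: w | w <- l] | a <- enum A]) [:: [::]].

Lemma mem_words_upto n w : size w <= n -> w \in words_upto n.
Proof.
elim: n w => [|n ih] [|a w] // hw; try exact: mem_head.
rewrite /words_upto iterS -/(words_upto n) in_cons; apply/flatten_mapP; exists a; first by rewrite mem_enum.
by apply: map_f; exact: ih.
Qed.

Definition inclusion_test (N N' : wba A) : bool :=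
  let ws := words_upto (word_bound N N') in
  ~~ has (fun u => has (fun v =>
    [&& size u != 0, size v != 0 & certificate K N N' u v]) ws) ws.

Lemma inclusion_testP N N' : reflect (qinclusion K N N') (inclusion_test N N').
Proof.
apply: (iffP idP) => [h|h].
  apply: contrapT => /certificate_complete[a [u [b [v]]]].
  move=> /certificate_bounded[u' [v' [hu hv hc]]]; move/negP: h; apply.
  apply/hasP; exists (a :: u'); first exact: mem_words_upto.
  by apply/hasP; exists (b :: v'); first exact: mem_words_upto.
apply/negP => /hasP[u _ /hasP[v _ /and3P[hu hv hc]]].
by apply: certificate_sound hc h; rewrite -size_eq0.
Qed.

End Bound.

(** * Computability of the test *)

#[global] Existing Instance letter_enc | 100.
#[global] Existing Instance wba_enc.

Ltac comp_var := first
  [ exact: comp_id | exact: comp_const | assumption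
  | apply: comp_fst; comp_var | apply: comp_snd; comp_var
  | match goal with
    | h : computable ?f |- computable (fun y => ?f (@?g y)) =>
        apply: (comp_comp (g := f) (f := g)); [exact: h | comp_var]
    end ].

Section Test.
Context {X : Type} `{Enc X} {A : finType} (K : Ksel).

Lemma comp_qbar_eq (x y : X -> qbar) :
  computable x -> computable y -> computable (fun t => x t == y t).
Proof. by move=> hx hy; apply: comp_eq => //; exact: qbar_enc_inj. Qed.

Lemma comp_opw (x y : X -> qbar) :
  computable x -> computable y -> computable (fun t => opw K (x t) (y t)).
Proof.
move=> hx hy; rewrite /opw; apply: comp_if; last apply: comp_if; last apply: comp_if;
  last apply: comp_if => //.
- by apply: comp_orb; apply: comp_qbar_eq => //; exact: comp_const.
- exact: comp_const.
- by apply: comp_qbar_eq => //; exact: comp_const.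
- by [].
- by apply: comp_qbar_eq => //; exact: comp_const.
- by [].
- by case: K; exact: comp_lt.
Qed.

Lemma comp_lasso_val (x y : X -> qbar) :
  computable x -> computable y -> computable (fun t => lasso_val K (x t) (y t)).
Proof.
move=> hx hy; rewrite /lasso_val; apply: comp_if; last first.
- have h : computable (fun t => if y t == +oo%E then x t else y t).
    by apply: comp_if => //; apply: comp_qbar_eq => //; exact: comp_const.
  by case: K (comp_opw hx hy).
- exact: comp_const.
- by apply: comp_orb; apply: comp_qbar_eq => //; exact: comp_const.
Qed.

End Test.

Lemma comp_arrows X `{Enc X} (A : finType) K (N : X -> wba A) (u : X -> seq A) :
  computable N -> computable u -> computable (fun x => arrows K (N x) (u x)).
Proof.
move=> hN hu; apply: comp_foldr => //.
  apply: comp_flatten; apply: comp_map; last by apply: comp_iota0; apply: comp_nstates; comp_var.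
  apply: comp_map; last by comp_var.
  apply: comp_pair; last by comp_var.
  apply: comp_pair; last by apply: comp_orb; [apply: comp_is_fin|]; comp_var.
  apply: comp_pair; first by comp_var.
  by apply: comp_opw; [apply: comp_weight|]; comp_var.
apply: comp_map; last by apply: comp_iota0; exact: comp_nstates.
by do ?apply: comp_pair; comp_var.
Qed.

Lemma comp_mem_arrow X `{Enc X} (e : X -> arrow) (l : X -> seq arrow) :
  computable e -> computable l -> computable (fun x => e x \in l x).
Proof.
move=> he hl; have h : computable (fun x => has (fun e' => e' == e x) (l x)).
  apply: comp_has => //; apply: comp_eq; try comp_var.
  apply: prod_enc_inj nat_enc_inj; apply: prod_enc_inj bool_enc_inj.
  exact: prod_enc_inj nat_enc_inj qbar_enc_inj.
by apply: (comp_retype (r := id) h) => // x; congr enc; exact: has_pred1.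
Qed.

Lemma comp_lassos X `{Enc X} (A : finType) K (N : X -> wba A) (u v : X -> seq A) :
  computable N -> computable u -> computable v -> computable (fun x => lassos K (N x) (u x) (v x)).
Proof.
move=> hN hu hv; apply: comp_flatten; apply: comp_map; last exact: comp_arrows.
apply: comp_flatten; apply: comp_map; last by apply: comp_arrows; comp_var.
apply: comp_if; last exact: comp_const.
  apply: comp_andb; first by apply: comp_is_init; comp_var.
  apply: comp_andb; first by apply: comp_eq; [exact: nat_enc_inj| |]; comp_var.
  by apply: comp_andb; [apply: comp_eq; [exact: nat_enc_inj| |]|]; comp_var.
by apply: comp_cons; [apply: comp_lasso_val|]; comp_var.
Qed.

Lemma comp_same_arrows X `{Enc X} (A : finType) K (N : X -> wba A) (u v : X -> seq A) :
  computable N -> computable u -> computable v ->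
  computable (fun x => same_arrows K (N x) (u x) (v x)).
Proof.
move=> hN hu hv.
by apply: comp_andb; apply: comp_all; (try exact: comp_arrows);
  apply: comp_mem_arrow; (try apply: comp_arrows); comp_var.
Qed.

Lemma comp_certificate X `{Enc X} (A : finType) K (N N' : X -> wba A) (u v : X -> seq A) :
  computable N -> computable N' -> computable u -> computable v ->
  computable (fun x => certificate K (N x) (N' x) (u x) (v x)).
Proof.
move=> hN hN' hu hv; apply: comp_andb; first by apply: comp_same_arrows => //; exact: comp_cat.
apply: comp_andb; first by apply: comp_same_arrows => //; exact: comp_cat.
apply: comp_has; last exact: comp_lassos.
apply: comp_andb; first by apply: comp_lt; comp_var.
by apply: comp_all; [apply: comp_lt|apply: comp_lassos]; comp_var.
Qed.

Lemma comp_words_upto X `{Enc X} (A : finType) (n : X -> nat) :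
  computable n -> computable (fun x => words_upto A (n x)).
Proof.
move=> hn; apply: comp_iter => //; last exact: comp_const.
apply: comp_cons; first exact: comp_const.
apply: comp_flatten; apply: comp_map; last exact: comp_const.
by apply: comp_map; [apply: comp_cons|]; comp_var.
Qed.

Lemma comp_word_bound X `{Enc X} (A : finType) (N N' : X -> wba A) :
  computable N -> computable N' -> computable (fun x => word_bound (N x) (N' x)).
Proof.
move=> /comp_nstates hN /comp_nstates hN'.
apply: comp_expn2; apply: comp_addn; do ![apply: comp_muln | apply: comp_succ];
  by [|exact: comp_const].
Qed.

Lemma comp_inclusion_test (A : finType) K :
  computable (fun p : wba A * wba A => inclusion_test K p.1 p.2).
Proof.
have h1 : computable (fun p : wba A * wba A => p.1) by comp_var.
have h2 : computable (fun p : wba A * wba A => p.2) by comp_var.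
have hw : computable (fun p : wba A * wba A => words_upto A (word_bound p.1 p.2)).
  by apply: comp_words_upto; exact: comp_word_bound.
apply: comp_negb; apply: comp_has => //.
apply: comp_has; last by apply: (comp_comp hw); comp_var.
apply: comp_andb.
  by apply: comp_negb; apply: comp_eq0; apply: comp_size; comp_var.
apply: comp_andb; first by apply: comp_negb; apply: comp_eq0; apply: comp_size; comp_var.
by apply: comp_certificate; comp_var.
Qed.

Theorem theorem7 (A : finType) (K : Ksel) :
  exists p : seq instr, forall N N' : wba A,
    halts_with p (enc_pair N N') (if `[< qinclusion K N N' >] then 1%N else 0%N).
Proof.
have [g hg eg] := comp_inclusion_test A K.
have [p hp] := comp1_halts hg; exists p => N N'.
have -> : (if `[< qinclusion K N N' >] then 1%N else 0%N) = g (enc_pair N N').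
  rewrite (eg (N, N') : g (enc_pair N N') = _) /=.
  have -> : inclusion_test K N N' = `[< qinclusion K N N' >].
    by apply/idP/asboolP => /inclusion_testP.
  by case: asbool.
exact: hp.
Qed.
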